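(* Let $\bm{T}$ be a $\bm{\sigma}$-Galton--Watson tree with type set $\mathfrak{G}$, and fix $\kappa\in\mathfrak{G}$. Let $(\mathcal{E}_n)_n$ be events with $\mathbb{P}(\mathcal{E}_n)>0$ for all $n$, and let $\bm{T}_n := (\bm{T}\mid \mathcal{E}_n)$. Suppose that $\mathbb{E}[\#_\kappa\bm{T}^\kappa]=2$ and that there is a deterministic sequence $s_n\to\infty$ such that for all $\epsilon>0$ $$\exp(-\epsilon s_n)=o(\mathbb{P}(\mathcal{E}_n))\qquad\text{and}\qquad \mathbb{P}(\#_\kappa\bm{T}_n\ge s_n)\to 1 .$$ Let $\mathfrak{G}_0\subset\mathfrak{G}$ be a non-empty subset such that for each $\gamma\in\mathfrak{G}_0\setminus\{\kappa\}$ $$\frac{\#_\gamma\bm{T}_n}{\#_\kappa\bm{T}_n}\xrightarrow{\;p\;}\mathbb{E}[\#_\gamma\bm{T}^\kappa]\in\,]0,\infty[ .$$ Let $v_n$ be a vertex of $\bm{T}_n$ drawn uniformly at random from all vertices with type in $\mathfrak{G}_0$. Set $p(\gamma)=\mathbb{E}[\#_\gamma\bm{T}^\kappa]$ for $\gamma\in\mathfrak{G}_0\setminus\{\kappa\}$, and $p(\kappa)=1$ in case $\kappa\in\mathfrak{G}_0$. If $$\frac{1}{\#_\kappa\bm{T}_n}\sum_{\gamma\in\mathfrak{G}_0}\#_\gamma\bm{T}_n\xrightarrow{\;p\;}\sum_{\gamma\in\mathfrak{G}_0}p(\gamma)<\infty,$$ then $$\mathfrak{L}((\bm{T}_n,v_n)\mid\bm{T}_n)\xrightarrow{\;p\;}\mathfrak{L}(\hat{\bm{T}}(\kappa,\eta))$$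 for an independent random type $\eta$ from $\mathfrak{G}_0$ with distribution $$\mathbb{P}(\eta=\gamma')=p(\gamma')\Big/\sum_{\gamma\in\mathfrak{G}_0}p(\gamma),\qquad \gamma'\in\mathfrak{G}_0 .$$
   Context: All limits are as $n\to\infty$; $\xrightarrow{p}$ is convergence in probability; $\mathfrak{L}$ denotes (conditional) laws. Types and trees. $\mathfrak{G}$ is a countable non-empty set of types. A $\mathfrak{G}$-type plane tree is a rooted ordered tree, each vertex having finitely many children, with a type in $\mathfrak{G}$ assigned to each vertex. $\#_iT$ is the number of vertices of type $i$ in $T$. The fringe subtree at a vertex is the tree formed by that vertex and all its descendants. Branching trees. $\bm{\sigma}=(\bm{\sigma}_i)_{i\in\mathfrak{G}}$ is an independent family of random finite words over $\mathfrak{G}$. The $\bm{\sigma}$-Galton--Watson tree $\bm{T}$ has root type given by an independent random type $\alpha$, and each vertex of type $i$ independently receives an ordered list of children with types given by an independent copy of $\bm{\sigma}_i$. Standing assumptions: $\mathbb{P}(\#_i\bm{T}\ne0)>0$ for all $i\in\mathfrak{G}$, and $\bm{T}$ is almost surely finite. $\bm{T}(\kappa)$ is the same tree started with a root of type $\kappa$. $\bm{T}^\kappa$ is defined like $\bm{T}(\kappa)$, except that non-root vertices of type $\kappa$ receive no offspring. The limit trees. When $\mathbb{E}[\#_\kappa\bm{T}^\kappa]=2$, $\hat{\bm{T}}^\kappa$ is the random marked tree with $\mathbb{P}(\hat{\bm{T}}^\kappa=(T,u))=\mathbb{P}(\bm{T}^\kappa=T)$ for every $\mathfrak{G}$-type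 tree $T$ (root of type $\kappa$, non-root type $\kappa$ vertices without offspring) and every non-root vertex $u$ of $T$ of type $\kappa$. For $\gamma\ne\kappa$ with $0<\mathbb{E}[\#_\gamma\bm{T}^\kappa]<\infty$, $\hat{\bm{T}}^{\kappa,\gamma}$ is the random marked tree with $\mathbb{P}(\hat{\bm{T}}^{\kappa,\gamma}=(T,u))=\mathbb{P}(\bm{T}^\kappa=T)/\mathbb{E}[\#_\gamma\bm{T}^\kappa]$ for every such finite $T$ and every vertex $u$ of $T$ of type $\gamma$. For $\gamma=\kappa$ set $\hat{\bm{T}}^{\kappa,\kappa}:=\hat{\bm{T}}^\kappa$. For any such $\gamma$ the infinite tree $\hat{\bm{T}}(\kappa,\gamma)$ is built as follows: there are vertices $u_0,u_1,\ldots$ of type $\kappa$; $u_0$ is the root of an independent copy of $\hat{\bm{T}}^{\kappa,\gamma}$, whose marked vertex is the marked vertex of $\hat{\bm{T}}(\kappa,\gamma)$ and whose non-root type $\kappa$ vertices all become roots of independent copies of $\bm{T}(\kappa)$; for each $i\ge1$, $u_i$ is the root of an independent copy of $\hat{\bm{T}}^\kappa$, whose marked vertex is identified with $u_{i-1}$ and whose non-marked, non-root type $\kappa$ vertices become roots of independent copies of $\bm{T}(\kappa)$. $\hat{\bm{T}}(\kappa,\eta)$ with random $\eta$ is the corresponding mixture. Space and convergence. For a marked tree $(T_1,v_1)$, $f^{[h]}(T_1,v_1)$ is the fringe subtree at the $h$-th ancestor of $v_1$ (the $0$-th being $v_1$), marked at $v_1$; if that ancestor does not exist it is $(T_1,v_1)$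 with an overflow flag. $\mathfrak{X}$ is the set of all finite marked $\mathfrak{G}$-type plane trees together with all locally finite $\mathfrak{G}$-type plane trees having a marked vertex with a countably infinite number of ancestors (hence no root) and all $f^{[h]}$ finite. Its metric is $d(T_1^\bullet,T_2^\bullet)=2$ if $f^{[0]}(T_1^\bullet)\neq f^{[0]}(T_2^\bullet)$, and $2^{-\sup\{h\ge0:\,f^{[h]}(T_1^\bullet)=f^{[h]}(T_2^\bullet)\}}$ otherwise ($2^{-\infty}=0$). The conditional law $\mathfrak{L}((\bm{T}_n,v_n)\mid\bm{T}_n)$ is the random Borel probability measure on $\mathfrak{X}$ which is uniform on the pairs $(\bm{T}_n,v)$, $v$ a vertex of $\bm{T}_n$ with type in $\mathfrak{G}_0$ (arbitrary if there is none); convergence in probability is with respect to the topology of weak convergence of probability measures on $\mathfrak{X}$. *)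

(* Defs.v *)
From HB Require Import structures.
From mathcomp Require Import all_boot all_order all_algebra.
From mathcomp Require Import all_classical all_reals all_analysis.
From mathcomp Require Import zify.

Set Implicit Arguments.
Unset Strict Implicit.
Unset Printing Implicit Defensive.

Import Order.TTheory GRing.Theory Num.Theory.
Import numFieldNormedType.Exports.

Local Open Scope classical_set_scope.
Local Open Scope ring_scope.

(* A countable non-empty set of types: mathcomp-analysis requires measurable
   spaces to be pointed, so non-emptiness is carried by a chosen element. *)
#[short(type="typeSet")]
HB.structure Definition TypeSet := {G of Pointed G & Countable G}.

HB.instance Definition _ (T : choiceType) := isPointed.Build (seq T) [::].

(* [T] with the discrete sigma-algebra; used for countable [T] only. *)
Definition discrete (T : Type) : Type := T.

Section DiscreteMeasurable.
Variable T : pointedType.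

HB.instance Definition _ := Pointed.on (discrete T).

Let meas : set_system (discrete T) := setT.
Let meas0 : meas set0. Proof. by []. Qed.
Let measC A : meas A -> meas (~` A). Proof. by []. Qed.
Let measU (F : (set (discrete T))^nat) :
  (forall i, meas (F i)) -> meas (\bigcup_i F i).
Proof. by []. Qed.

HB.instance Definition _ := @isMeasurable.Build default_measure_display
  (discrete T) meas meas0 measC measU.

End DiscreteMeasurable.

Section PlaneTrees.
Context {G : Type}.

Inductive ptree := Node of G & seq ptree.

Definition rtype (t : ptree) : G := let: Node g _ := t in g.
Definition children (t : ptree) : seq ptree := let: Node _ s := t in s.

Section Induction.
Variable Q : ptree -> Prop.
Hypothesis IH : forall g s, foldr (fun t A => Q t /\ A) True s -> Q (Node g s).

Fixpoint ptree_nested_ind (t : ptree) : Q t :=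
  let: Node g s := t in
  IH g ((fix all_ind (s : seq ptree) :
           foldr (fun t A => Q t /\ A) True s :=
           if s is t' :: s' then conj (ptree_nested_ind t') (all_ind s')
           else I) s).
End Induction.

(* Vertices are addressed by Ulam-Harris words: [k :: v] is the vertex at
   address [v] of the subtree at the [k]-th child of the root (from 0). *)
Fixpoint fringe (t : ptree) (v : seq nat) : option ptree :=
  if v is k :: v' then obind (fringe^~ v') (onth (children t) k) else Some t.

Definition vertex (t : ptree) (v : seq nat) : bool := fringe t v.

Definition vtype (t : ptree) (v : seq nat) : option G := omap rtype (fringe t v).

Fixpoint vertices (t : ptree) : seq (seq nat) :=
  let: Node _ s := t in
  [::] :: flatten [seq [seq p.1 :: v | v <- p.2]
                  | p <- zip (iota 0 (size s)) [seq vertices c | c <- s]].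

(* [graft t B] replaces, for every vertex [v] of [t] with [B v = Some t']
   having no proper ancestor with that property, the fringe subtree at [v]
   by [t']. *)
Fixpoint graft (t : ptree) : (seq nat -> option ptree) -> ptree :=
  let: Node g s := t in fun B =>
  if B [::] is Some t' then t' else
  Node g [seq p.2 (fun v => B (p.1 :: v))
         | p <- zip (iota 0 (size s)) [seq graft c | c <- s]].

End PlaneTrees.
Arguments ptree : clear implicits.

Section PlaneTreeCountable.

Fixpoint ptree_encode (G : Type) (t : ptree G) : GenTree.tree G :=
  let: Node g s := t in
  GenTree.Node 0 (GenTree.Leaf g :: [seq ptree_encode c | c <- s]).

Fixpoint ptree_decode (G : Type) (e : GenTree.tree G) : option (ptree G) :=
  if e is GenTree.Node _ (GenTree.Leaf g :: s) then
    Some (Node g (pmap id [seq ptree_decode c | c <- s]))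
  else None.

Lemma ptree_encodeK (G : Type) : pcancel (@ptree_encode G) (@ptree_decode G).
Proof.
elim/(@ptree_nested_ind G) => g s IH /=; congr (Some (Node g _)).
by elim: s IH => //= t s IHs [-> /IHs ->].
Qed.

HB.instance Definition _ (G : eqType) :=
  Equality.copy (ptree G) (pcan_type (@ptree_encodeK G)).
HB.instance Definition _ (G : choiceType) :=
  Choice.copy (ptree G) (pcan_type (@ptree_encodeK G)).
HB.instance Definition _ (G : countType) :=
  Countable.copy (ptree G) (pcan_type (@ptree_encodeK G)).
HB.instance Definition _ (G : typeSet) :=
  isPointed.Build (ptree G) (Node point [::]).

End PlaneTreeCountable.

Definition ntype (G : eqType) (g : G) (t : ptree G) : nat :=
  count (fun v => vtype t v == Some g) (vertices t).

(* [t] is the tree grown from its root when a vertex at address [v] of type [g]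
   receives the ordered list of children with types [off v g]. *)
Definition grown (G : Type) (off : seq nat -> G -> seq G) (t : ptree G) : Prop :=
  forall v s, fringe t v = Some s ->
    [seq rtype c | c <- children s] = off v (rtype s).

Definition stop_at (G : eqType) (kappa : G) (off : seq nat -> G -> seq G)
    (v : seq nat) (g : G) : seq G :=
  if (v != [::]) && (g == kappa) then [::] else off v g.

Section Probability.
Context d (Omega : measurableType d) (R : realType) (P : probability Omega R).

Definition mutually_independent (I : eqType) (S : I -> set_system Omega) : Prop :=
  forall (J : seq I) (A : I -> set Omega), uniq J ->
    (forall i, i \in J -> S i (A i)) ->
    P (\bigcap_(i in [set` J]) A i) = (\prod_(i <- J) P (A i))%E.

Definition generated d' (T : measurableType d') (X : Omega -> T) :
    set_system Omega :=
  preimage_set_system [set: Omega] X measurable.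

(* [P(. | E)]; the last argument of [mnormalize] is its (irrelevant) value when
   [P E = 0]. *)
Definition cond_prob (E : set Omega) (mE : measurable E) : probability Omega R :=
  mnormalize (mrestr P mE) P.

End Probability.

(* Convergence in probability to the constant [l] of random elements [X n] of a
   topological space, each defined on [Omega] under its own probability [Pn n]. *)
Definition cvg_in_prob d (Omega : measurableType d) (R : realType)
    (Pn : nat -> probability Omega R)
    (T : topologicalType) (X : nat -> Omega -> T) (l : T) : Prop :=
  forall U : set T, open_nbhs l U ->
    Pn n [set w | U (X n w)] @[n --> \oo] --> 1%E.

Section BranchingTrees.
Context d (Omega : measurableType d) (R : realType) (P : probability Omega R).
Context (G : typeSet).
Variables (sigma : G -> probability (discrete (seq G)) R)
          (alpha : {RV P >-> discrete G})
          (xi : seq nat -> G -> {RV P >-> discrete (seq G)}).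

(* [xi v g] is the copy of the random word [sigma g] read by a vertex at
   address [v] if its type is [g]. *)
Definition offspring_family : Prop :=
  (forall v g A, distribution P (xi v g) A = sigma g A) /\
  mutually_independent P (fun j : option (seq nat * G) =>
    if j is Some (v, g) then generated (xi v g) else generated alpha).

(* [ptree] only contains finite trees, so each of the following predicates also
   says that the tree it describes is almost surely finite. *)
Definition gw_tree (T : {RV P >-> discrete (ptree G)}) : Prop :=
  {ae P, forall w, rtype (T w) = alpha w /\
                   grown (fun v g => xi v g w) (T w)}.

Definition gw_tree_from (kappa : G) (T : {RV P >-> discrete (ptree G)}) : Prop :=
  {ae P, forall w, rtype (T w) = kappa /\
                   grown (fun v g => xi v g w) (T w)}.

Definition gw_tree_stopped (kappa : G) (T : {RV P >-> discrete (ptree G)}) :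
    Prop :=
  {ae P, forall w, rtype (T w) = kappa /\
                   grown (stop_at kappa (fun v g => xi v g w)) (T w)}.

End BranchingTrees.

Definition mean_ntype d (Omega : measurableType d) (R : realType)
    (P : probability Omega R) (G : typeSet) (g : G)
    (T : {RV P >-> discrete (ptree G)}) : \bar R :=
  'E_P[fun w => (ntype g (T w))%:R].

Section LimitSpace.
Context (G : typeSet).

(* [(t, v)] with the fringe subtree of [t] at the [h]-th ancestor of [v] and the
   address of [v] in it; equal to [(t, v)] if this ancestor does not exist,
   since then [size v - h = 0]. *)
Definition ancestor_fringe (h : nat) (p : ptree G * seq nat) :
    ptree G * seq nat :=
  let: (t, v) := p in
  (odflt t (fringe t (take (size v - h) v)), drop (size v - h) v).

Definition marked_tree : Type := {p : ptree G * seq nat | vertex p.1 p.2}.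

(* A locally finite plane tree whose marked vertex has infinitely many
   ancestors, with all fringe subtrees at these ancestors finite, is the
   increasing union of those fringe subtrees. It is given (up to isomorphism)
   by the sequence [x] where [x h] is the fringe subtree at the [h]-th ancestor
   together with the address of the marked vertex in it. *)
Definition spine_tree : Type :=
  {x : nat -> ptree G * seq nat |
    forall h, [/\ vertex (x h).1 (x h).2, size (x h).2 = h &
                  x h = ancestor_fringe h (x h.+1)]}.

(* The space depends on [R] only through the codomain of its metric. *)
Inductive limit_space (R : realType) : Type :=
| Fin of marked_tree
| Inf of spine_tree.

Context (R : realType).
Local Notation X := (limit_space R).

(* $f^{[h]}$, with its overflow flag. *)
Definition fringe_at (h : nat) (x : X) : (ptree G * seq nat) * bool :=
  match x with
  | Fin p => (ancestor_fringe h (sval p), (size (sval p).2 < h)%N)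
  | Inf y => (sval y h, false)
  end.

Definition dist (x y : X) : R :=
  if `[< fringe_at 0 x = fringe_at 0 y >] then
    match ereal_sup [set h%:R%:E |
                     h in [set h : nat | fringe_at h x = fringe_at h y]] with
    | r%:E => 2 `^ (- r)
    | _ => 0
    end
  else 2.

Lemma fringe_cat (t : ptree G) u v :
  fringe t (u ++ v) = obind (fringe^~ v) (fringe t u).
Proof. by elim: u t => //= k u IH t; case: onth => //=. Qed.

Lemma ancestor_fringe_id h (p : ptree G * seq nat) :
  (size p.2 <= h)%N -> ancestor_fringe h p = p.
Proof.
case: p => t v /= vh; have /eqP -> : (size v - h == 0)%N by rewrite subn_eq0.
by rewrite take0 drop0.
Qed.

Lemma ancestor_fringe_fringe h (p : ptree G * seq nat) : vertex p.1 p.2 ->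
  ancestor_fringe h (ancestor_fringe h.+1 p) = ancestor_fringe h p.
Proof.
have [sp _|hp] := leqP (size p.2) h.+1; first by rewrite (ancestor_fringe_id sp).
case: p hp => t v /= hv vtv.
set a := (size v - h.+1)%N; set b := (size v - h)%N.
have sd : (size (drop a v) - h = 1)%N.
  by rewrite size_drop /a; lia.
have tb : take b v = take a v ++ take 1 (drop a v).
  rewrite -[in LHS](cat_take_drop a v) take_cat size_takel ?leq_subr//.
  have -> : (b - a = 1)%N by rewrite /a /b; lia.
  by have -> : (b < a)%N = false by rewrite /a /b; lia.
rewrite sd drop_drop; congr (_, drop _ v); last by rewrite /a /b; lia.
rewrite tb fringe_cat.
case: (fringe t (take a v)) (fringe_cat t (take a v) (drop a v)) => [s|] /=.
  rewrite cat_take_drop => e; move: vtv; rewrite /vertex e.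
  case: (drop a v) sd => [|k l] //= _; case: onth => //= c; rewrite take0.
  by [].
by rewrite cat_take_drop => e; move: vtv; rewrite /vertex e.
Qed.

Lemma fringe_at_down h (x y : X) :
  fringe_at h.+1 x = fringe_at h.+1 y -> fringe_at h x = fringe_at h y.
Proof.
have size_af (p : ptree G * seq nat) k :
    size (ancestor_fringe k p).2 = minn (size p.2) k.
  by case: p => t v /=; rewrite size_drop; lia.
case: x => [[p vp]|[x xP]]; case: y => [[q vq]|[y yP]] //= [e].
- move=> b; have ef := congr1 (ancestor_fringe h) e.
  rewrite !ancestor_fringe_fringe// in ef; congr (_, _) => //.
  have := congr1 (fun r => size r.2) e; rewrite !size_af; move: b; lia.
- move=> b; have [_ _ ->] := yP h; rewrite -e ancestor_fringe_fringe//.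
  by congr (_, _); move: b; lia.
- move=> b; have [_ _ ->] := xP h; rewrite e ancestor_fringe_fringe//.
  by congr (_, _); move: b; lia.
- by have [_ _ ->] := xP h; have [_ _ ->] := yP h; rewrite e.
Qed.

Lemma fringe_at_le h k (x y : X) : (h <= k)%N ->
  fringe_at k x = fringe_at k y -> fringe_at h x = fringe_at h y.
Proof.
move=> hk; elim: k hk => [|k IH]; first by rewrite leqn0 => /eqP ->.
by rewrite leq_eqVlt => /predU1P[->//|/IH {}IH /fringe_at_down].
Qed.

Lemma fringe_at_inj (x y : X) : (forall h, fringe_at h x = fringe_at h y) -> x = y.
Proof.
case: x => [[p vp]|[x xP]]; case: y => [[q vq]|[y yP]] /= e.
- congr Fin; apply/eqP; rewrite -val_eqE/=; apply/eqP.
  have [e1 _] := e (maxn (size p.2) (size q.2)).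
  by move: e1; rewrite !ancestor_fringe_id ?leq_maxl ?leq_maxr.
- by have [_] := e (size p.2).+1; rewrite ltnS leqnn.
- by have [_] := e (size q.2).+1; rewrite ltnS leqnn.
- congr Inf; apply: eq_exist => /=; apply/funext => h.
  by have [] := e h.
Qed.

Let agree_sup (x y : X) (k : nat) :
  (forall h, (h <= k)%N -> fringe_at h x = fringe_at h y) ->
  fringe_at k.+1 x <> fringe_at k.+1 y ->
  ereal_sup [set h%:R%:E | h in [set h : nat | fringe_at h x = fringe_at h y]]
  = k%:R%:E :> \bar R.
Proof.
move=> xy nxy; apply/eqP; rewrite eq_le; apply/andP; split.
  apply: ge_ereal_sup => _ [h /= exy <-]; rewrite lee_fin ler_nat leqNgt.
  by apply/negP => /fringe_at_le /(_ exy).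
by apply: ereal_sup_ubound; exists k => //=; exact: xy.
Qed.

Let distE (x y : X) (m : nat) :
  (forall h, (h < m)%N -> fringe_at h x = fringe_at h y) -> fringe_at m x <> fringe_at m y ->
  dist x y = 2 * 2^-1 ^+ m.
Proof.
case: m => [_ /asboolPn/negbTE xy|k xy nxy].
  by rewrite /dist xy expr0 mulr1.
rewrite /dist; case: asboolP => [_|]; last by case; exact: xy.
rewrite (agree_sup xy nxy) powRN powR_mulrn ?ler0n// exprS mulrA mulfV//.
by rewrite mul1r exprVn.
Qed.

Let dist_xx (x : X) : dist x x = 0.
Proof.
rewrite /dist; case: asboolP => // _.
suff -> : ereal_sup [set h%:R%:E |
                     h in [set h : nat | fringe_at h x = fringe_at h x]] =
  +oo%E :> \bar R by [].
apply/eqyP => r r0; apply: (@le_trans _ _ (Num.truncn r).+1%:R%:E).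
  by rewrite lee_fin ltW// truncnS_gt.
by apply: ereal_sup_ubound; exists (Num.truncn r).+1.
Qed.

Let first_diff (x y : X) : x <> y -> exists2 m,
  forall h, (h < m)%N -> fringe_at h x = fringe_at h y & fringe_at m x <> fringe_at m y.
Proof.
move=> xy; have ex : exists m, `[< fringe_at m x <> fringe_at m y >].
  have /existsNP[m xym] : ~ forall m, fringe_at m x = fringe_at m y by move=> /fringe_at_inj.
  by exists m; exact/asboolP.
case: (ex_minnP ex) => m /asboolP xym mmin; exists m => // h hm.
by apply: contrapT => /asboolP/mmin; rewrite leqNgt hm.
Qed.

Let dist_ge0 (x y : X) : 0 <= dist x y.
Proof.
have [->|/first_diff[m xy nxy]] := pselect (x = y); first by rewrite dist_xx.
by rewrite (distE xy nxy) mulr_ge0// exprn_ge0// invr_ge0.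
Qed.

Let dist_eq0 (x y : X) : dist x y = 0 -> x = y.
Proof.
apply: contraPP => /first_diff[m xy nxy]; rewrite (distE xy nxy).
by apply/eqP; rewrite mulf_neq0// expf_neq0// invr_neq0.
Qed.

Let dist_sym (x y : X) : dist x y = dist y x.
Proof.
have [->//|/first_diff[m xy nxy]] := pselect (x = y).
rewrite (distE xy nxy) (@distE _ _ m)// => [h hm|/esym//].
by rewrite xy.
Qed.

Let dist_triangle (y x z : X) : dist x z <= dist x y + dist y z.
Proof.
have h0 : (0 : R) <= 2^-1 by rewrite invr_ge0.
have h1 : (2^-1 : R) <= 1 by rewrite invf_le1 ?ler1n.
have [->|/first_diff[m xz nxz]] := pselect (x = z).
  by rewrite dist_xx addr_ge0.
have [->|/first_diff[k xy nxy]] := pselect (x = y); first by rewrite lerDr.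
have [->|/first_diff[l yz nyz]] := pselect (y = z); first by rewrite lerDl.
have [km|mk] := leqP k m.
  apply: (@le_trans _ _ (dist x y)); last by rewrite lerDl.
  by rewrite (distE xz nxz) (distE xy nxy) ler_wpM2l// ler_wiXn2l.
apply: (@le_trans _ _ (dist y z)); last by rewrite lerDr.
rewrite (distE xz nxz) (distE yz nyz) ler_wpM2l// ler_wiXn2l//.
by rewrite leqNgt; apply/negP => ml; apply: nxz; rewrite xy// yz.
Qed.

HB.instance Definition _ := gen_eqMixin X.
HB.instance Definition _ := gen_choiceMixin X.
HB.instance Definition _ := isMetric.Build R X
  dist_xx dist_eq0 dist_sym dist_triangle.
HB.instance Definition _ :=
  isPointed.Build X (Fin R (exist _ (Node point [::], [::]) isT)).

End LimitSpace.

Section WeakConvergence.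
Context (R : realType) (S : ptopologicalType).

Definition borel : measurableType _ := g_sigma_algebraType (@open S).

Definition bounded_continuous : Type :=
  {f : S -> R^o | continuous f /\ bounded_fun f}.

HB.instance Definition _ := gen_eqMixin bounded_continuous.
HB.instance Definition _ := gen_choiceMixin bounded_continuous.

Definition integrals (mu : probability borel R) :
    {ptws bounded_continuous -> R^o} :=
  fun f => \int[mu]_x sval f x.

(* Probability measures on [S] with the topology of weak convergence. *)
Definition weak_probability : topologicalType := initial_topology integrals.

End WeakConvergence.
Arguments borel : clear implicits.
Arguments weak_probability : clear implicits.

Section EmpiricalFringe.
Context (R : realType) (G : typeSet) (G0 : set G).

Definition marked_in (t : ptree G) : seq (marked_tree G) :=
  pmap insub [seq (t, v) | v <- vertices t &
                           if vtype t v is Some g then g \in G0 else false].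

(* The uniform law on the pairs [(t, v)] with [v] a vertex of type in [G0];
   [mu0 t] if there is no such vertex. *)
Definition fringe_law
    (mu0 : ptree G -> probability (borel (limit_space G R)) R) (t : ptree G) :
    probability (borel (limit_space G R)) R :=
  let s : seq (borel (limit_space G R)) := [seq Fin R p | p <- marked_in t] in
  mnormalize (msum (fun i => \d_(nth point s i)) (size s)) (mu0 t).

End EmpiricalFringe.

Section LimitTree.
Context (G : typeSet) (kappa : G).

(* Vertex addresses of a blob at which a copy of the branching tree from
   [kappa] is attached; [c v] is the copy attached at [v]. *)
Definition kappa_copies (t : ptree G) (c : seq nat -> ptree G) (v : seq nat) :
    option (ptree G) :=
  if (v != [::]) && (vtype t v == Some kappa) then Some (c v) else None.

(* The fringe subtree of the limit tree at [u_i], with the address of the marked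
   vertex: [z i] is the marked tree rooted at [u_i] and [c i v] the copy attached
   at its vertex [v]. *)
Fixpoint spine (z : nat -> ptree G * seq nat) (c : nat -> seq nat -> ptree G)
    (i : nat) : ptree G * seq nat :=
  let: (t, u) := z i in
  if i is j.+1 then
    let: (t', u') := spine z c j in
    (graft t (fun v => if v == u then Some t' else kappa_copies t (c i) v),
     u ++ u')
  else (graft t (kappa_copies t (c 0%N)), u).

Definition is_limit_tree (R : realType) (z : nat -> ptree G * seq nat)
    (c : nat -> seq nat -> ptree G) (x : limit_space G R) : Prop :=
  exists y, x = Inf R y /\
    forall i, sval y (size (spine z c i).2) = spine z c i.

Section Laws.
Context d (Omega : measurableType d) (R : realType) (P : probability Omega R)
  (Tstop : {RV P >-> discrete (ptree G)}).

Definition marked_blob_law d' (Omega' : measurableType d')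
    (P' : probability Omega' R) (gamma : G)
    (Z : {RV P' >-> discrete (ptree G * seq nat)%type}) : Prop :=
  if gamma == kappa then
    forall t u, u != [::] -> vtype t u = Some kappa ->
      distribution P' Z [set (t, u)] = distribution P Tstop [set t]
  else
    forall t u, vtype t u = Some gamma ->
      distribution P' Z [set (t, u)] =
      (distribution P Tstop [set t] *
       ((fine (mean_ntype gamma Tstop))^-1)%:E)%E.

(* [p], the weight of each type in the law of the limiting marked type. *)
Definition type_weight (gamma : G) : \bar R :=
  if gamma == kappa then 1%E else mean_ntype gamma Tstop.

End Laws.
End LimitTree.

Section LimitTreeLaw.
Context (G : typeSet) (kappa : G) (G0 : set G).
Context d (Omega : measurableType d) (R : realType) (P : probability Omega R)
  (Tkappa Tstop : {RV P >-> discrete (ptree G)}).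
Context d' (Omega' : measurableType d') (P' : probability Omega' R)
  (eta : {RV P' >-> discrete G})
  (Z0 : G -> {RV P' >-> discrete (ptree G * seq nat)%type})
  (Z : nat -> {RV P' >-> discrete (ptree G * seq nat)%type})
  (C : nat -> seq nat -> {RV P' >-> discrete (ptree G)}).

(* [eta] is the type of the marked vertex; [Z0 gamma] is the marked tree rooted
   at [u_0] when this type is [gamma], [Z i] the one rooted at [u_(i+1)], and
   [C i v] the copy of the tree from [kappa] attached at vertex [v] of the tree
   rooted at [u_i]. *)
Definition limit_tree_components : Prop :=
  [/\ forall gamma, gamma \in G0 ->
        distribution P' eta [set gamma] =
        (fine (type_weight kappa Tstop gamma) /
         fine (\esum_(g in G0) type_weight kappa Tstop g))%:E,
      forall gamma, gamma \in G0 -> marked_blob_law kappa Tstop gamma (Z0 gamma),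
      forall i, marked_blob_law kappa Tstop kappa (Z i),
      forall i v A, distribution P' (C i v) A = distribution P Tkappa A
    & mutually_independent P' (fun j : option (G + (nat + nat * seq nat)) =>
        match j with
        | None => generated eta
        | Some (inl gamma) => generated (Z0 gamma)
        | Some (inr (inl i)) => generated (Z i)
        | Some (inr (inr (i, v))) => generated (C i v)
        end)].

Definition limit_tree (That : {RV P' >-> borel (limit_space G R)}) : Prop :=
  {ae P', forall w, is_limit_tree kappa
     (fun i => if i is j.+1 then Z j w else Z0 (eta w) w)
     (fun i v => C i v w) (That w)}.

End LimitTreeLaw.

(* Main.v *)
Require Import Defs.
From HB Require Import structures.
From mathcomp Require Import all_boot all_order all_algebra.
From mathcomp Require Import all_classical all_reals all_analysis.
From mathcomp Require Import measurable_realfun ring lra zify.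

Set Implicit Arguments.
Unset Strict Implicit.
Unset Printing Implicit Defensive.

Import Order.TTheory GRing.Theory Num.Theory.
Import numFieldNormedType.Exports.

Local Open Scope classical_set_scope.
Local Open Scope ring_scope.

(* Write w(t) for the product over the vertices of t of the probabilities of
   their offspring, so that P(T(kappa) = t) = w(t) when t has root type kappa.

   The spine construction multiplies the laws of independent blobs, and cutting a
   tree tau at its vertices of type kappa factors w(tau) in the same way. Hence
   the limit law gives mass at most w(tau) / sum p to the cylinder of all trees
   in which the fringe subtree at the ancestor at distance |v| of the marked
   vertex is tau, marked at v. The empirical law gives the same cylinder mass
   N_tau(T_n) / #_{G0} T_n, where N_tau counts the fringe subtrees equal to tau.
   By a portmanteau argument only lower bounds on these masses are needed, so it
   suffices that N_tau(T_n) >= (w(tau) - delta) #_kappa T_n with high probability.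

   This lower tail is exponentially small already for the unconditioned tree,
   which beats the conditioning on an event of probability exp(-o(s_n)). For
   x < 1 < y the tilted mass w(t) x^{N_tau} y^{#_kappa}, with the tilt applied
   only at depth less than n, sums to at most 1 over all trees with a given root type:
   this is an induction on n, because a further level contributes a factor at
   most y (1 - (1 - x) w(tau)), which is at most 1 for suitable x and y. *)

(** * Plane trees *)

(** Lower bounds suffice because the empirical laws are probability measures: once finitely many
    disjoint cylinders carry almost all of the limit law and each receives nearly its share, no mass
    is left to go elsewhere.

    The limit law is bounded above by independence alone: a given finite tree at a given level of
    the spine forces the values of finitely many components. The probability of the type of the
    marked vertex cancels the normalisation of the corresponding marked blob, so the bound does not
    depend on that type.

    Both counts in the tilt are sums over the vertices of an indicator of the fringe subtree there.
    The tilted mass therefore factors at the root like w itself, which is what permits an induction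
    by levels. The saving (1 - x) w(tau) at a root of type kappa survives the tilting of deeper
    levels because no proper fringe subtree of tau equals tau: below the root of a copy of tau the
    tilt can only increase the mass. *)

Section Indexed.
Context {T : Type}.

(** [vertices] and [graft] pair each child with its position through such a [zip]; naming it turns
    sums over child addresses into big operators over pairs. *)
Definition indexed (s : seq T) : seq (nat * T) := zip (iota 0 (size s)) s.

Lemma unzip2_indexed s : unzip2 (indexed s) = s.
Proof. by rewrite unzip2_zip ?size_iota. Qed.

Lemma unzip1_indexed s : unzip1 (indexed s) = iota 0 (size s).
Proof. by rewrite unzip1_zip ?size_iota. Qed.

Lemma big_indexed (U : Type) (idx : U) (op : U -> U -> U) (s : seq T) F :
  \big[op/idx]_(p <- indexed s) F p.2 = \big[op/idx]_(c <- s) F c.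
Proof. by rewrite -[in RHS](unzip2_indexed s) big_map. Qed.

Lemma onth_map_indexed (U : Type) (f : nat * T -> U) (s : seq T) k :
  onth [seq f p | p <- indexed s] k = omap (fun c => f (k, c)) (onth s k).
Proof.
rewrite /indexed; suff H m : onth [seq f p | p <- zip (iota m (size s)) s] k
    = omap (fun c => f ((k + m)%N, c)) (onth s k) by rewrite H addn0.
elim: s m k => [|c s IH] m k; first by rewrite !onth0n.
by case: k => [|k] //=; rewrite IH addSnnS.
Qed.

End Indexed.

Lemma zip_mapr (S T U : Type) (f : T -> U) (r : seq S) (s : seq T) :
  zip r [seq f c | c <- s] = [seq (p.1, f p.2) | p <- zip r s].
Proof. by elim: r s => [|x r IH] [|c s] //=; rewrite IH. Qed.

Lemma indexed_map (T U : Type) (f : U -> T) (s : seq U) :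
  indexed [seq f c | c <- s] = [seq (p.1, f p.2) | p <- indexed s].
Proof. by rewrite /indexed size_map zip_mapr. Qed.

Lemma mem_indexed (T : eqType) (s : seq T) k c :
  ((k, c) \in indexed s) = (onth s k == Some c).
Proof.
rewrite /indexed; suff H m : ((k, c) \in zip (iota m (size s)) s)
    = (m <= k)%N && (onth s (k - m) == Some c) by rewrite H /= subn0.
elim: s m => [|c' s IH] m /=; first by rewrite onth0n andbF.
rewrite in_cons IH xpair_eqE; case: (ltngtP m k) => [mk|km|->].
- by rewrite -(subnSK mk).
- by [].
- by rewrite subnn /= orbF eq_sym.
Qed.

Section Trees.
Context {G : typeSet}.
Implicit Types (t c : ptree G) (s : seq (ptree G)) (u v : seq nat) (g kappa : G).

Lemma ptree_mem_ind (Q : ptree G -> Prop) :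
  (forall g s, (forall c, c \in s -> Q c) -> Q (Node g s)) -> forall t, Q t.
Proof.
move=> IH; elim/(@ptree_nested_ind G) => g s Qs; apply: IH.
by elim: s Qs => //= t s IHs [Qt Qs] c /predU1P[->//|/IHs]; exact.
Qed.

Lemma vertices_node g s : vertices (Node g s) =
  [::] :: flatten [seq [seq p.1 :: v | v <- vertices p.2] | p <- indexed s].
Proof. by rewrite /= zip_mapr -map_comp. Qed.

Lemma graft_node g s B : graft (Node g s) B =
  if B [::] is Some t' then t' else
  Node g [seq graft p.2 (fun v => B (p.1 :: v)) | p <- indexed s].
Proof. by rewrite /= zip_mapr -map_comp. Qed.

Lemma mem_vertices t v : (v \in vertices t) = vertex t v.
Proof.
rewrite /vertex; elim/ptree_mem_ind: t v => g s IH v; rewrite vertices_node in_cons.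
case: v => [|k v] //=; apply/flatten_mapP/idP => [[[j c]]|].
  rewrite mem_indexed => /eqP jc /mapP[u uc [-> ->]]; rewrite jc/= -IH//.
  by apply/onthP; exists j.
case ek: onth => [c|] //= vc; exists (k, c); first by rewrite mem_indexed ek.
by apply/mapP; exists v => //=; rewrite IH//; apply/onthP; exists k.
Qed.

Lemma vertices_uniq t : uniq (vertices t).
Proof.
elim/ptree_mem_ind: t => g s IH; rewrite vertices_node /=; apply/andP; split.
  by apply/negP => /flatten_mapP[p _ /mapP[]].
have : uniq (unzip1 (indexed s)) by rewrite unzip1_indexed iota_uniq.
have : {subset unzip2 (indexed s) <= s} by rewrite unzip2_indexed.
elim: (indexed s) => //= -[k c] r IHr sub /andP[kr ur]; rewrite cat_uniq.
rewrite map_inj_uniq; last by move=> ? ? [].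
rewrite IH/=; last by apply: sub; rewrite in_cons eqxx.
rewrite IHr//; last by move=> x xr; apply: sub; rewrite in_cons xr orbT.
rewrite andbT -all_predC; apply/allP => x /flatten_mapP[[j d] jr /mapP[u _ ->]] /=.
apply/mapP => -[u' _ [jk _]]; move/negP: kr; apply; rewrite -jk.
by apply/mapP; exists (j, d).
Qed.

Lemma big_vertices (U : Type) (idx : U) (op : Monoid.law idx) g s Q F :
  \big[op/idx]_(v <- vertices (Node g s) | Q v) F v =
  op (if Q [::] then F [::] else idx) (\big[op/idx]_(p <- indexed s)
     \big[op/idx]_(v <- vertices p.2 | Q (p.1 :: v)) F (p.1 :: v)).
Proof.
rewrite vertices_node big_mkcond big_cons big_flatten big_map; congr (op _ _).
by apply: eq_bigr => p _; rewrite big_map [RHS]big_mkcond.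
Qed.

(** Both [weight] and [tilted] are instances, so the recursion at the root is proved once. *)
Definition fringe_prod (R : pzSemiRingType) (F : ptree G -> R) t : R :=
  \prod_(v <- vertices t) F (odflt t (fringe t v)).

Lemma fringe_prod_node (R : pzSemiRingType) (F : ptree G -> R) g s :
  fringe_prod F (Node g s) = F (Node g s) * \prod_(c <- s) fringe_prod F c.
Proof.
rewrite /fringe_prod big_vertices /=; congr (_ * _).
rewrite -[RHS]big_indexed; apply: eq_big_seq => -[k c].
rewrite mem_indexed => /eqP kc; apply: eq_big_seq => v /=.
by rewrite mem_vertices /vertex kc /=; case: fringe.
Qed.

(* On the fringe subtree at [u_i] of the limit tree this count is [i.+1], which
   recovers [i] from the tree and the address of its marked vertex. *)
Fixpoint kcount kappa t v : nat :=
  if v is k :: v' then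
    ((rtype t == kappa) +
     if onth (children t) k is Some c then kcount kappa c v' else 0)%N
  else 0%N.

Lemma kcount_cat kappa t u v c : fringe t u = Some c ->
  kcount kappa t (u ++ v) = (kcount kappa t u + kcount kappa c v)%N.
Proof.
elim: u t => [|k u IH] t /= => [[->]//|].
by case: onth => //= d /IH ->; rewrite addnA.
Qed.

Lemma kcount_root kappa t v : rtype t = kappa -> v != [::] ->
  (0 < kcount kappa t v)%N.
Proof. by case: v => // k v /= -> _; rewrite eqxx. Qed.

Lemma kcount_size kappa t v : (kcount kappa t v <= size v)%N.
Proof.
elim: v t => //= k v IH t; rewrite -add1n leq_add ?leq_b1//.
by case: onth => // c; exact: IH.
Qed.

(** * Pruning at the vertices of type kappa *)

(** The root of a blob has type [kappa] and yet keeps its children. The recursion therefore lives in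
    [prune], which cuts below every [kappa] vertex including its root, and [blob] applies it to the
    child subtrees. *)
Fixpoint prune kappa t : ptree G :=
  let: Node g s := t in
  Node g (if g == kappa then [::] else [seq prune kappa c | c <- s]).

Definition blob kappa t : ptree G :=
  Node (rtype t) [seq prune kappa c | c <- children t].

Lemma fringe_prune kappa t u : fringe (prune kappa t) u -> fringe t u.
Proof.
elim: u t => [|k u IH] [g s] //=.
by case: ifP => _; rewrite ?onth0n// onth_map; case: onth => //= c; exact: IH.
Qed.

Lemma prune_leaf kappa t u : vtype (prune kappa t) u = Some kappa ->
  fringe (prune kappa t) u = Some (Node kappa [::]).
Proof.
rewrite /vtype; elim: u t => [|k u IH] [g s] /=.
  by case=> ->; rewrite eqxx.
by case: ifP => _; rewrite ?onth0n// onth_map; case: onth => //= c; exact: IH.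
Qed.

Lemma blob_leaf kappa t u : u != [::] -> vtype (blob kappa t) u = Some kappa ->
  fringe (blob kappa t) u = Some (Node kappa [::]).
Proof.
case: u => // k u _; rewrite /vtype /= onth_map.
by case: onth => //= c; exact: prune_leaf.
Qed.

(** Leaves form an antichain of addresses, so an address extends at most one of them. Hence the
    address of the marked vertex determines where the spine leaves a blob. *)
Lemma fringe_leaf_prefix kappa t u1 u2 r1 r2 :
    fringe t u1 = Some (Node kappa [::]) ->
    fringe t u2 = Some (Node kappa [::]) ->
  u1 ++ r1 = u2 ++ r2 -> u1 = u2.
Proof.
elim: u1 u2 t => [|k u1 IH] [|j u2] [g s] //=.
- by case=> _ ->; rewrite onth0n.
- by move=> + [_ ss]; rewrite ss onth0n.
by case ek: onth => [c|]//= e1 + [kj]; rewrite -kj ek /= => e2 /(IH _ _ e1 e2) ->.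
Qed.

(** [kappa_copies] without the exception for the root, as seen from a child subtree of the blob. *)
Definition prune_copies kappa t (b : seq nat -> ptree G) v : option (ptree G) :=
  if vtype t v == Some kappa then Some (b v) else None.

Definition graft_prune kappa t b := graft t (prune_copies kappa t b).

Lemma graft_prune_node kappa g s b : graft_prune kappa (Node g s) b =
  if g == kappa then b [::] else
  Node g [seq graft_prune kappa p.2 (fun v => b (p.1 :: v)) | p <- indexed s].
Proof.
rewrite /graft_prune graft_node {1}/prune_copies /vtype /= -[Some g == _]/(g == kappa).
case: (g == kappa) => //; congr Node; apply/eq_in_map => -[k c].
rewrite mem_indexed => /eqP kc; congr graft; apply/funext => v /=.
by rewrite /prune_copies /vtype /= kc.
Qed.

Lemma graft_blob_node kappa g s b : graft (Node g s) (kappa_copies kappa (Node g s) b) =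
  Node g [seq graft_prune kappa p.2 (fun v => b (p.1 :: v)) | p <- indexed s].
Proof.
rewrite graft_node /=; congr Node; apply/eq_in_map => -[k c].
rewrite mem_indexed => /eqP kc; congr graft; apply/funext => v /=.
by rewrite /kappa_copies /prune_copies /vtype /= kc.
Qed.

Section GraftPrune.
Variable kappa : G.
Implicit Types b : seq nat -> ptree G.

(** The equation [prune kappa t = t] is the working form of the condition that all vertices of type
    [kappa] in [t] are leaves. It passes to the children; when the root has type [kappa] there are
    none. *)
Let fixed_children g s : g != kappa ->
  prune kappa (Node g s) = Node g s -> forall c, c \in s -> prune kappa c = c.
Proof.
move=> /negbTE /= -> [] e c /onthP[k kc].
by have := congr1 (fun l => onth l k) e; rewrite /= onth_map kc => -[].
Qed.

Lemma rtype_graft_prune t b : (forall v, rtype (b v) = kappa) ->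
  rtype (graft_prune kappa t b) = rtype t.
Proof. by case: t => g s bk; rewrite graft_prune_node; case: eqP => // ->. Qed.

Lemma prune_graft t b : prune kappa t = t -> (forall v, rtype (b v) = kappa) ->
  prune kappa (graft_prune kappa t b) = t.
Proof.
elim/ptree_mem_ind: t b => g s IH b tK bk; rewrite graft_prune_node.
have [gk|gk] := eqVneq g kappa.
  move: tK => /=; rewrite gk eqxx => -[<-].
  by case: (b [::]) (bk [::]) => g' s' /= ->; rewrite eqxx.
rewrite /= (negbTE gk) -map_comp; congr Node; apply: eq_from_onth => k.
rewrite onth_map_indexed; case kc: onth => [c|] //=; congr Some.
have cs : c \in s by apply/onthP; exists k.
by apply: IH => //; exact: (fixed_children gk tK).
Qed.

Lemma fringe_graft_prune t b v : vtype t v = Some kappa -> prune kappa t = t ->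
  fringe (graft_prune kappa t b) v = Some (b v).
Proof.
elim/ptree_mem_ind: t b v => g s IH b v; rewrite graft_prune_node /vtype.
case: v => [/= [->]|k v /=]; first by rewrite eqxx.
case kc: onth => [c|] //= vk tK; have cs : c \in s by apply/onthP; exists k.
have [gk|gk] := eqVneq g kappa.
  by move: tK kc; rewrite gk eqxx => -[<-]; rewrite onth0n.
by rewrite /= onth_map_indexed kc /= IH//; exact: (fixed_children gk tK).
Qed.

Lemma vtype_graft_prune t b v : vertex t v -> prune kappa t = t ->
  (forall v, rtype (b v) = kappa) ->
  vtype (graft_prune kappa t b) v = vtype t v.
Proof.
rewrite /vertex /vtype; elim/ptree_mem_ind: t b v => g s IH b v.
case: v => [_ _ bk|k v /=]; first by rewrite /= rtype_graft_prune.
case kc: onth => [c|] //= vk tK bk; have cs : c \in s by apply/onthP; exists k.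
rewrite graft_prune_node; have [gk|gk] := eqVneq g kappa.
  by move: tK kc; rewrite gk eqxx => -[<-]; rewrite onth0n.
by rewrite /= onth_map_indexed kc /= IH//; exact: (fixed_children gk tK).
Qed.

Lemma kcount_graft_prune t b v : vertex t v -> prune kappa t = t ->
  kcount kappa (graft_prune kappa t b) v = 0%N.
Proof.
rewrite /vertex; elim/ptree_mem_ind: t b v => g s IH b [|k v] //=.
case kc: onth => [c|] //= vk tK; have cs : c \in s by apply/onthP; exists k.
rewrite graft_prune_node; have [gk|gk] := eqVneq g kappa.
  by move: tK kc; rewrite gk eqxx => -[<-]; rewrite onth0n.
rewrite /= (negbTE gk) onth_map_indexed kc /= IH//.
exact: (fixed_children gk tK).
Qed.

End GraftPrune.

Section GraftBlob.
Variables (kappa : G) (t : ptree G) (b : seq nat -> ptree G).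
Hypotheses (tK : blob kappa t = t) (bk : forall v, rtype (b v) = kappa).
Local Notation gr := (graft t (kappa_copies kappa t b)).

Let fixed c : c \in children t -> prune kappa c = c.
Proof.
case: t tK => g s /= -[] e /onthP[k kc].
by have := congr1 (fun l => onth l k) e; rewrite /= onth_map kc => -[].
Qed.

Lemma rtype_graft_blob : rtype gr = rtype t.
Proof. by case: t => g s; rewrite graft_blob_node. Qed.

(** Cutting undoes grafting: together with [fringe_graft_blob] this recovers all ingredients of a
    spine step from the glued tree. *)
Lemma blob_graft : blob kappa gr = t.
Proof.
case: t fixed => g s fx; rewrite graft_blob_node /blob /=; congr Node.
rewrite -map_comp; apply: eq_from_onth => k.
rewrite onth_map_indexed; case kc: onth => [c|] //=; congr Some.
by apply: prune_graft => //; apply: fx; apply/onthP; exists k.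
Qed.

Lemma fringe_graft_blob v : v != [::] -> vtype t v = Some kappa ->
  fringe gr v = Some (b v).
Proof.
case: t fixed => g s fx; case: v => // k v _; rewrite graft_blob_node /vtype /=.
rewrite onth_map_indexed; case kc: onth => [c|] //= vk.
by rewrite fringe_graft_prune//; apply: fx; apply/onthP; exists k.
Qed.

Lemma vtype_graft_blob v : vertex t v -> vtype gr v = vtype t v.
Proof.
case: t fixed => g s fx; case: v => [|k v]; rewrite graft_blob_node /vtype /vertex //=.
rewrite onth_map_indexed; case kc: onth => [c|] //= vk.
have := @vtype_graft_prune kappa c (fun v => b (k :: v)) v vk.
by rewrite /vtype => ->//; apply: fx; apply/onthP; exists k.
Qed.

(** The non-root [kappa] vertices of a blob are leaves, so none lies strictly between the root and
    [v], and [kcount] does not count [v] itself. *)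
Lemma kcount_graft_blob v : rtype t = kappa -> v != [::] -> vertex t v ->
  kcount kappa gr v = 1%N.
Proof.
case: t fixed => g s fx; case: v => // k v; rewrite graft_blob_node /vertex /=.
move=> -> _; rewrite eqxx onth_map_indexed; case kc: onth => [c|] //= vk.
by rewrite kcount_graft_prune//; apply: fx; apply/onthP; exists k.
Qed.

End GraftBlob.
End Trees.

(** * Finite masses of branching trees *)

Section Submass.
Context {R : realType}.

(** Total mass at most one on [A], stated through duplicate-free lists so that all comparisons and
    products of masses stay finite computations. *)
Definition submass (X : eqType) (A : pred X) (f : X -> R) : Prop :=
  forall r : seq X, uniq r -> {in r, forall x, A x} -> \sum_(x <- r) f x <= 1.

Lemma submass_le (X : eqType) (A B : pred X) (f h : X -> R) :
  {subset B <= A} -> {in B, forall x, h x <= f x} ->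
  submass A f -> submass B h.
Proof.
move=> BA hf Af r ur rB; apply: le_trans (Af r ur _); last first.
  by move=> x xr; apply: BA; exact: rB.
by rewrite !big_seq; apply: ler_sum => x xr; apply: hf; exact: rB.
Qed.

Lemma submass_inj (X Y : eqType) (A : pred X) (B : pred Y) (f : X -> R)
    (i : Y -> X) :
  {in B &, injective i} -> {in B, forall y, A (i y)} ->
  submass A f -> submass B (f \o i).
Proof.
move=> inj BA Af r ur rB; rewrite -(big_map i xpredT f); apply: Af.
  by rewrite map_inj_in_uniq// => y z yr zr; apply: inj; apply: rB.
by move=> _ /mapP[y yr ->]; apply: BA; exact: rB.
Qed.

(** Two-stage sampling: after grouping by the first coordinate, each inner sum is bounded by the
    mass of [h x] and the outer sum by that of [f]. *)
Lemma submass_pair (X Y : eqType) (A : pred X) (B : X -> pred Y)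
    (f : X -> R) (h : X -> Y -> R) :
  (forall x, 0 <= f x) -> submass A f -> (forall x, A x -> submass (B x) (h x)) ->
  submass [pred p | A p.1 && B p.1 p.2] (fun p => f p.1 * h p.1 p.2).
Proof.
move=> f0 Af Bh r ur rAB; pose u := undup [seq p.1 | p <- r].
have -> : \sum_(p <- r) f p.1 * h p.1 p.2 =
    \sum_(x <- u) \sum_(p <- r | p.1 == x) f x * h x p.2.
  under [RHS]eq_bigr => x _ do rewrite big_mkcond.
  rewrite exchange_big /= !big_seq; apply: eq_bigr => p pr.
  rewrite (bigD1_seq p.1) ?undup_uniq//=; last first.
    by rewrite mem_undup; apply/mapP; exists p.
  rewrite eqxx big1 ?addr0// => x xp.
  by rewrite eq_sym (negbTE xp).
apply: le_trans (Af u (undup_uniq _) _); last first.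
  by move=> x; rewrite mem_undup => /mapP[p pr ->]; have /andP[] := rAB _ pr.
rewrite !big_seq; apply: ler_sum => x; rewrite mem_undup => /mapP[p0 p0r xE].
have Ax : A x by have /andP[] := rAB _ p0r; rewrite xE.
rewrite -mulr_sumr ler_piMr// -big_filter -(big_map snd xpredT (h x)).
apply: (Bh x Ax).
  rewrite map_inj_in_uniq ?filter_uniq//.
  move=> [a b] [c d]; rewrite !mem_filter /= => /andP[/eqP -> _] /andP[/eqP -> _].
  by move=> ->.
move=> y /mapP[p]; rewrite mem_filter => /andP[/eqP <- pr] ->.
by have /andP[] := rAB _ pr.
Qed.

End Submass.

Section FringeSize.
Context {G : typeSet}.
Implicit Types t u : ptree G.

Lemma size_fringe t v u : fringe t v = Some u ->
  (size (vertices u) + size v <= size (vertices t))%N.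
Proof.
elim: v t => [|k v IH] [g s] => [[<-]|]; first by rewrite addn0.
rewrite [vertices (Node g s)]vertices_node /=.
case kc: onth => [c|] //= /IH uc; rewrite addnS ltnS.
apply: leq_trans uc _; rewrite size_flatten /shape -map_comp.
have : (k, c) \in indexed s by rewrite mem_indexed kc.
elim: (indexed s) => //= p r IHr; rewrite in_cons => /predU1P[<-|/IHr h] /=.
  by rewrite size_map leq_addr.
exact: leq_trans h (leq_addl _ _).
Qed.

(** A proper fringe subtree has strictly fewer vertices. *)
Lemma fringe_not_above t k c v : onth (children t) k = Some c ->
  fringe c v <> Some t.
Proof.
move=> kc ct; have : fringe t (k :: v) = Some t by rewrite /= kc.
by move/size_fringe; rewrite /= addnS -ltn_subRL subnn.
Qed.

Definition fringe_count tau t : nat :=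
  count (fun v => fringe t v == Some tau) (vertices t).

Definition offspring t : seq G := [seq rtype c | c <- children t].

End FringeSize.

Section Weight.
Context {G : typeSet} {R : realType}.
Variable a : G -> seq G -> R.
Hypothesis a_ge0 : forall g r, 0 <= a g r.
Hypothesis a_sum : forall g, submass predT (a g).
Implicit Types (t c : ptree G) (s : seq (ptree G)).

Definition weight : ptree G -> R :=
  fringe_prod (fun u => a (rtype u) (offspring u)).

Lemma weightE t :
  weight t = a (rtype t) (offspring t) * \prod_(c <- children t) weight c.
Proof. by case: t => g s; rewrite /weight fringe_prod_node. Qed.

Lemma weight_ge0 t : 0 <= weight t.
Proof. by apply: prodr_ge0 => v _. Qed.

Let rooted g : pred (ptree G) := fun t => rtype t == g.

Lemma submass_forest (h : ptree G -> R) (r : seq G) :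
  (forall t, 0 <= h t) -> (forall g, submass (rooted g) h) ->
  submass [pred s | [seq rtype c | c <- s] == r] (fun s => \prod_(c <- s) h c).
Proof.
move=> h0 hh; elim: r => [|g r IH].
  (* Only the empty forest has no root types, so a duplicate-free list of such forests has at most
     one entry. *)
  move=> [|s [|s' l]] //=; first by rewrite big_nil.
    move=> _ sP; rewrite big_seq1; have := sP _ (mem_head _ _).
    by case: s sP => //= _ _; rewrite big_nil.
  move=> + sP; have := sP _ (mem_head _ _).
  have : s' \in [:: s, s' & l] by rewrite !inE eqxx orbT.
  by move=> /sP; case: s' sP => //; case: s.
have := @submass_pair R _ _ (rooted g)
  (fun _ => [pred s | [seq rtype c | c <- s] == r]) h
  (fun _ s => \prod_(c <- s) h c) h0 (hh g) (fun _ _ => IH).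
move=> /(@submass_inj _ _ _ _ [pred s | [seq rtype c | c <- s] == g :: r] _
  (fun s => (head point s, behead s))) H.
apply: submass_le (H _ _) => //.
- by move=> [|c s] //= _; rewrite big_cons.
- by move=> [|c s] [|c' s'] //= _ _ [-> ->].
- by move=> [|c s] //= /eqP [cg sr]; rewrite /rooted cg sr !eqxx.
Qed.

(** One generation of branching: the offspring word is drawn from [a g], then the subtrees are drawn
    with mass [h]. *)
Lemma submass_tree (h : ptree G -> R) g :
  (forall t, 0 <= h t) -> (forall g, submass (rooted g) h) ->
  submass (rooted g) (fun t => a g (offspring t) * \prod_(c <- children t) h c).
Proof.
move=> h0 hh.
have := @submass_pair R _ _ predT
  (fun r => [pred s | [seq rtype c | c <- s] == r]) (a g)
  (fun _ s => \prod_(c <- s) h c) (a_ge0 g) (@a_sum g)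
  (fun r _ => submass_forest (r := r) h0 hh).
move=> /(@submass_inj _ _ _ _ (rooted g) _ (fun t => (offspring t, children t))).
apply; last by move=> t _ /=; rewrite eqxx.
by move=> [g1 s1] [g2 s2] /eqP /= -> /eqP /= -> [_ ->].
Qed.

(** * Exponential tilting and the lower tail of fringe counts *)

Section Tilt.
Variables (kappa : G) (tau : ptree G) (x y : R).

Definition tilt_factor t : R :=
  (if rtype t == kappa then y else 1) * (if t == tau then x else 1).

Definition tilted : ptree G -> R :=
  fringe_prod (fun u => a (rtype u) (offspring u) * tilt_factor u).

Lemma tiltedE t :
  tilted t = weight t * (y ^+ ntype kappa t * x ^+ fringe_count tau t).
Proof.
rewrite /tilted /fringe_prod big_split /= big_split /= -!big_mkcond /=.
congr (_ * (_ * _)); rewrite big_const_seq iter_mulr_1.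
  congr (_ ^+ _); rewrite /ntype; apply: eq_in_count => v.
  by rewrite mem_vertices /vertex /vtype; case: fringe.
congr (_ ^+ _); rewrite /fringe_count; apply: eq_in_count => v.
by rewrite mem_vertices /vertex; case: fringe.
Qed.

(** Subtrees at depth [n] have mass [base]. The base 0 serves to show that [weight] is a submass.
    For the actual tilt the base is [weight], because the induction needs the mass below the root of
    [tau] to be at least that of [weight] at every [n]. *)
Fixpoint tilted_upto (base : ptree G -> R) n t : R :=
  if n is m.+1 then
    a (rtype t) (offspring t) * tilt_factor t *
      \prod_(c <- children t) tilted_upto base m c
  else base t.

Lemma tilted_upto_ge0 base n t : 0 <= x -> 0 <= y -> (forall t, 0 <= base t) ->
  0 <= tilted_upto base n t.
Proof.
move=> x0 y0 b0; elim: n t => //= n IH t.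
rewrite mulr_ge0 ?prodr_ge0// mulr_ge0// /tilt_factor.
by do 2 case: ifP => _; rewrite mulr_ge0.
Qed.

(** Once [n] exceeds the height of [t], the recursion ends at the leaves and never reaches
    [base]. *)
Lemma tilted_upto_eq t : exists N, forall n, (N <= n)%N -> forall base,
  tilted_upto base n t = tilted t.
Proof.
elim/(@ptree_mem_ind G): t => g s IH.
have [N HN] : exists N, forall n, (N <= n)%N -> forall base,
    {in s, forall c, tilted_upto base n c = tilted c}.
  elim: s IH => [|c s IHs] IH; first by exists 0%N.
  have [N1 H1] := IH c (mem_head _ _).
  have [|N2 H2] := IHs; first by move=> d ds; apply: IH; rewrite in_cons ds orbT.
  exists (maxn N1 N2) => n; rewrite geq_max => /andP[n1 n2] base d.
  by rewrite in_cons => /predU1P[->|ds]; [exact: H1|exact: H2].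
exists N.+1 => -[//|n] Nn base /=; rewrite /tilted fringe_prod_node; congr (_ * _).
by apply: eq_big_seq => c cs; exact: HN.
Qed.

Lemma tilted_upto_eq_seq (r : seq (ptree G)) : exists n, forall base,
  {in r, forall t, tilted_upto base n t = tilted t}.
Proof.
suff [N HN] : exists N, forall n, (N <= n)%N -> forall base,
    {in r, forall c, tilted_upto base n c = tilted c}.
  by exists N => base; exact: HN.
elim: r => [|c r [N2 H2]]; first by exists 0%N.
have [N1 H1] := tilted_upto_eq c.
exists (maxn N1 N2) => n; rewrite geq_max => /andP[n1 n2] base d.
by rewrite in_cons => /predU1P[->|ds]; [exact: H1|exact: H2].
Qed.

End Tilt.

Lemma submass_weight g : submass (rooted g) weight.
Proof.
(* For [x = y = 1] there is no tilt, whatever the type and the tree, and the zero base makes the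
   initial case trivial. *)
have H n g' : submass (rooted g') (tilted_upto point point 1 1 (fun=> 0) n).
  elim: n g' => [|n IH] g'; first by move=> r _ _; rewrite big1.
  apply: submass_le (submass_tree (g := g') _ IH) => //; last first.
    by move=> t; apply: tilted_upto_ge0.
  move=> t /eqP tg /=; rewrite tg /tilt_factor.
  by do 2 case: ifP => _; rewrite !mulr1.
move=> r ur rg; have [n Hn] := tilted_upto_eq_seq point point 1 1 r.
apply: le_trans (H n g r ur rg); rewrite le_eqVlt; apply/orP; left; apply/eqP.
by apply: eq_big_seq => t tr; rewrite Hn// tiltedE !expr1n !mulr1.
Qed.

Section TiltMass.
Variables (kappa : G) (tau : ptree G) (x y : R).
Hypotheses (tau_kappa : rtype tau = kappa) (x0 : 0 <= x) (x1 : x <= 1) (y1 : 1 <= y).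
Hypothesis xy : y * (1 - (1 - x) * weight tau) <= 1.

(** Away from [tau] the tilt consists of factors [y >= 1] only. *)
Lemma le_weight_tilted_upto n t : (forall v, fringe t v <> Some tau) ->
  weight t <= tilted_upto kappa tau x y weight n t.
Proof.
elim: n t => //= n IH t tN; rewrite weightE ler_pM ?prodr_ge0//.
- by move=> c _; exact: weight_ge0.
- have tt : (t == tau) = false by apply/eqP => e; apply: (tN [::]); rewrite e.
  by rewrite /tilt_factor tt mulr1; case: ifP => _; rewrite ?mulr1// ler_peMr.
- rewrite !big_seq; apply: ler_prod => c /onthP[k kc]; rewrite weight_ge0/= IH//.
  by move=> v cv; apply: (tN (k :: v)); rewrite /= kc.
Qed.

Lemma submass_tilted_upto n g :
  submass (rooted g) (tilted_upto kappa tau x y weight n).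
Proof.
have y0 : 0 <= y by exact: le_trans y1.
have T0 m t := @tilted_upto_ge0 kappa tau x y _ m t x0 y0 weight_ge0.
elim: n g => [|n IH] g; first exact: submass_weight.
have KM := @submass_tree _ g (T0 n) IH.
have [gk|gk] := eqVneq g kappa; last first.
  (* A root of another type carries no tilt, since [tau] has root type [kappa]. *)
  apply: submass_le KM => // t /eqP tg /=; rewrite tg /tilt_factor tg (negbTE gk).
  have tt : (t == tau) = false.
    by apply/eqP => e; move: gk; rewrite -tg e tau_kappa eqxx.
  by rewrite tt !mulr1.
rewrite gk {gk} in KM *.
(* [K] is the mass before the tilt at the root. *)
pose K t := a kappa (offspring t) *
  \prod_(c <- children t) tilted_upto kappa tau x y weight n c.
rewrite -/K in KM.
have K0 t : 0 <= K t by rewrite mulr_ge0// prodr_ge0.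
have Ktau : weight tau <= K tau.
  rewrite weightE tau_kappa ler_wpM2l//= !big_seq.
  apply: ler_prod => c /onthP[k kc]; rewrite weight_ge0 /=.
  by apply: le_weight_tilted_upto => v; exact: fringe_not_above kc.
move=> r ur rk.
(* The saving comes from the term of [tau], so [tau] is put into the list; this can only increase
   the sum. *)
pose r' := if tau \in r then r else tau :: r.
have ur' : uniq r' by rewrite /r'; case: ifPn => //= ->.
have tr' : tau \in r' by rewrite /r'; case: ifPn => // _; rewrite mem_head.
have rk' : {in r', forall t, rooted kappa t}.
  rewrite /r'; case: ifPn => // _ t; rewrite in_cons => /predU1P[->|/rk//].
  by rewrite /rooted tau_kappa.
have rr' : \sum_(t <- r) tilted_upto kappa tau x y weight n.+1 t <=
           \sum_(t <- r') tilted_upto kappa tau x y weight n.+1 t.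
  by rewrite /r'; case: ifPn => // _; rewrite big_cons lerDr T0.
apply: (le_trans rr').
have -> : \sum_(t <- r') tilted_upto kappa tau x y weight n.+1 t =
    y * (\sum_(t <- r') K t - (1 - x) * K tau).
  rewrite !(bigD1_seq tau tr' ur')/= tau_kappa /tilt_factor tau_kappa !eqxx.
  rewrite -/(K tau) addrAC mulrDr; congr (_ + _).
    rewrite /K; ring.
  rewrite mulr_sumr big_seq_cond [RHS]big_seq_cond; apply: eq_bigr => t.
  move=> /andP[/rk' /eqP -> /negbTE ->].
  by rewrite eqxx mulr1 /K mulrA; congr (_ * _); exact: mulrC.
apply: le_trans xy; rewrite ler_pM2l; last exact: lt_le_trans y1.
rewrite lerB//; first exact: KM.
by rewrite ler_wpM2l// subr_ge0.
Qed.

Lemma submass_tilted g : submass (rooted g) (tilted kappa tau x y).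
Proof.
move=> r ur rg; have [n Hn] := tilted_upto_eq_seq kappa tau x y r.
apply: le_trans (submass_tilted_upto n ur rg).
by rewrite le_eqVlt; apply/orP; left; apply/eqP; apply: eq_big_seq => t tr; rewrite Hn.
Qed.

End TiltMass.

Lemma lower_tail (b : G -> R) (kappa : G) (tau : ptree G) (delta s : R)
    (r : seq (ptree G)) :
  (forall g, 0 <= b g) -> submass predT b -> rtype tau = kappa -> 0 < delta ->
  uniq r ->
  {in r, forall t, s <= (ntype kappa t)%:R /\
    (fringe_count tau t)%:R < (weight tau - delta) * (ntype kappa t)%:R} ->
  \sum_(t <- r) b (rtype t) * weight t <= expR (- (delta ^+ 2 / 4 * s)).
Proof.
move=> b0 b1 tk d0 ur rP; set q := weight tau.
(* For [q < delta] the count would be smaller than a nonpositive number, so [r] is empty. *)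
have [qd|dq] := ltP q delta.
  case: r ur rP => [_ _|t r _ /(_ t (mem_head _ _))[_]].
    by rewrite big_nil expR_ge0.
  rewrite ltNge => /negP[]; apply: le_trans (ler0n _ _).
  by rewrite mulr_le0_ge0// subr_le0 ltW.
(* On the trees of [r] the tilt [y ^ k * x ^ N = exp (l * ((q - delta / 2) * k - N))] is at least
   [exp (l * (delta / 2) * k)]; with [l = delta / 2] and [k >= s] this is the claimed exponent. *)
pose l := delta / 2; pose x := expR (- l); pose y := expR (l * (q - delta / 2)).
have l0 : 0 < l by rewrite divr_gt0.
have x0 : 0 <= x by exact: expR_ge0.
have x1 : x <= 1 by rewrite -expR0 ler_expR oppr_le0 ltW.
have y1 : 1 <= y.
  by rewrite -expR0 ler_expR mulr_ge0 ?ltW// subr_gt0; apply: lt_le_trans dq; lra.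
have q0 : 0 <= q by exact: weight_ge0.
have q1 : q <= 1.
  have := @submass_weight kappa [:: tau]; rewrite big_seq1; apply => // t.
  by rewrite inE => /eqP ->; rewrite /rooted tk.
have xy : y * (1 - (1 - x) * q) <= 1.
  have h1 : 1 - (1 - x) * q <= expR (- ((1 - x) * q)) by exact: expR_ge1Dx.
  apply: (@le_trans _ _ (y * expR (- ((1 - x) * q)))).
    by rewrite ler_wpM2l// expR_ge0.
  rewrite -expRD expR_le1 subr_le0.
  (* This gives [l <= (1 - x) * (1 + l)]. As [delta / 2 = l], it remains that
     [(q - l) * (1 + l) <= q], which holds because [q <= 1]. *)
  have h2 : x * (1 + l) <= 1.
    apply: (@le_trans _ _ (x * expR l)); first by rewrite ler_wpM2l// expR_ge1Dx.
    by rewrite -expRD addNr expR0.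
  have h3 : l * (q - delta / 2) * (1 + l) <= (1 - x) * q * (1 + l).
    have : l * q <= (1 - x) * q * (1 + l).
      by rewrite [leRHS]mulrAC; apply: ler_wpM2r => //; lra.
    apply: le_trans; rewrite -/l -mulrA ler_wpM2l ?(ltW l0)//.
    have lq : q * l <= l * 1 by rewrite mulrC ler_wpM2l// ltW.
    have := sqr_ge0 l; rewrite expr2 => l2.
    by lra.
  by rewrite -(ler_pM2r (_ : 0 < 1 + l))//; lra.
have tm := @submass_tilted kappa tau x y tk x0 x1 y1 xy.
have bt : submass predT (fun t => b (rtype t) * tilted kappa tau x y t).
  have := @submass_pair R _ _ predT rooted b (fun _ t => tilted kappa tau x y t)
    b0 b1 (fun g _ => tm g).
  move=> /(@submass_inj _ _ _ _ predT _ (fun t => (rtype t, t))); apply.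
    by move=> t u _ _ [].
  by move=> t _; rewrite /= /rooted eqxx.
apply: (@le_trans _ _ (\sum_(t <- r) b (rtype t) * tilted kappa tau x y t *
    expR (- (delta ^+ 2 / 4 * s)))); last first.
  by rewrite -mulr_suml ler_piMl ?expR_ge0//; exact: bt.
rewrite !big_seq; apply: ler_sum => t /rP[st Nt].
rewrite -mulrA ler_wpM2l// tiltedE -mulrA ler_peMr ?weight_ge0//.
rewrite /x /y -!expRM_natl -!expRD -[leLHS]expR0 ler_expR.
move: st Nt; rewrite -/q.
set k := (ntype kappa t)%:R; set N := (fringe_count tau t)%:R => st Nt.
rewrite /l.
have h : 0 <= delta * ((q - delta) * k - N) by rewrite mulr_ge0 ?ltW// subr_gt0.
have h' : 0 <= delta ^+ 2 * (k - s) by rewrite mulr_ge0 ?sqr_ge0// subr_ge0.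
nra.
Qed.

(* The vertices of type [kappa] that are not allowed to reproduce in a tree
   stopped at [kappa] contribute no factor. *)
Definition blob_weight kappa t : R :=
  \prod_(v <- vertices t | ~~ ((v != [::]) && (vtype t v == Some kappa)))
    a (rtype (odflt t (fringe t v))) (offspring (odflt t (fringe t v))).

(** Counterpart of [blob_weight] for child subtrees, whose root may itself be a stopped vertex. *)
Definition pruned_weight kappa t : R :=
  \prod_(v <- vertices t | vtype t v != Some kappa)
    a (rtype (odflt t (fringe t v))) (offspring (odflt t (fringe t v))).

Lemma weight_prune kappa t : weight t = pruned_weight kappa (prune kappa t) *
  \prod_(u <- vertices (prune kappa t) | vtype (prune kappa t) u == Some kappa)
    weight (odflt t (fringe t u)).
Proof.
elim/(@ptree_mem_ind G): t => g s IH; have [->|gk] := eqVneq g kappa.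
  rewrite /= eqxx /pruned_weight /vtype /= !big_cons !big_nil /=.
  by rewrite (eqxx (Some kappa)) mul1r mulr1.
have gkN : (Some g == Some kappa) = false by apply/negbTE.
have -> : prune kappa (Node g s) = Node g [seq prune kappa c | c <- s].
  by rewrite /= (negbTE gk).
rewrite weightE /pruned_weight !big_vertices /vtype /= gkN mul1r /offspring /= -map_comp.
rewrite !indexed_map !big_map /= -mulrA -big_split /=; congr (_ * _).
  by congr a; apply: eq_map => -[].
rewrite -[LHS]big_indexed; apply: eq_big_seq => -[k c].
rewrite mem_indexed => /eqP kc; rewrite IH; last by apply/onthP; exists k.
rewrite /pruned_weight /= !onth_map kc /=; congr (_ * _).
  rewrite big_seq_cond [RHS]big_seq_cond; apply: eq_bigr => v.
  by rewrite mem_vertices /vertex /vtype; case: fringe.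
rewrite big_seq_cond [RHS]big_seq_cond; apply: eq_bigr => v.
rewrite mem_vertices /vertex => /andP[vc _].
by case: (fringe c v) (fringe_prune vc).
Qed.

Lemma weight_blob kappa t : rtype t = kappa ->
  weight t = blob_weight kappa (blob kappa t) *
  \prod_(u <- vertices (blob kappa t) |
         (u != [::]) && (vtype (blob kappa t) u == Some kappa))
    weight (odflt t (fringe t u)).
Proof.
case: t => g s gk; rewrite weightE /blob_weight /blob [children (Node g s)]/=.
rewrite !big_vertices /= mul1r.
rewrite /offspring /= -map_comp !indexed_map !big_map /= -mulrA -big_split /=.
congr (_ * _); first by congr a; apply: eq_map => -[].
rewrite -[LHS]big_indexed; apply: eq_big_seq => -[k c].
rewrite mem_indexed => /eqP kc; rewrite (weight_prune kappa c) /pruned_weight.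
rewrite /vtype /= !onth_map kc /=; congr (_ * _).
  rewrite big_seq_cond [RHS]big_seq_cond; apply: eq_bigr => v.
  by rewrite mem_vertices /vertex /vtype; case: fringe.
rewrite big_seq_cond [RHS]big_seq_cond; apply: eq_bigr => v.
rewrite mem_vertices /vertex => /andP[vc _].
by case: (fringe c v) (fringe_prune vc).
Qed.

End Weight.

(** * Laws on countable sets *)

Section CountableLaw.
Context {T : pointedType} {R : realType} (mu : probability (discrete T) R).
Variables (enc : T -> nat) (encI : injective enc).
Local Open Scope ereal_scope.

Lemma law_seq (r : seq T) : uniq r ->
  mu [set` r] = \sum_(x <- r) mu [set x].
Proof.
elim: r => [_|x r IH /= /andP[xr ur]].
  by rewrite big_nil (_ : [set` [::]] = set0) ?measure0//; apply/seteqP; split.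
rewrite big_cons -IH// -measureU//.
  congr (mu _); apply/seteqP; split=> y /=; rewrite in_cons.
    by move=> /predU1P[]; [left|right].
  by move=> -[->|->]; rewrite ?eqxx ?orbT.
by apply/seteqP; split=> // y [-> /=]; rewrite (negbTE xr).
Qed.

Lemma law_seq_le (r : seq T) (A : set T) : uniq r -> {in r, forall x, A x} ->
  \sum_(x <- r) mu [set x] <= mu A.
Proof. by move=> ur rA; rewrite -law_seq// le_measure ?inE. Qed.

(** The fibres of the injection [enc] are points or empty, so the integral is a series whose partial
    sums run over finite lists. *)
Lemma integral_law_le (F : T -> R) (b : \bar R) : (forall x, (0 <= F x)%R) ->
  (forall r : seq T, uniq r -> \sum_(x <- r) (F x)%:E * mu [set x] <= b) ->
  \int[mu]_x (F x)%:E <= b.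
Proof.
move=> F0 Fb; pose D n : set (discrete T) := enc @^-1` [set n].
have DT : \bigcup_n D n = setT by apply/seteqP; split=> // x _; exists (enc x).
have tD : trivIset setT D.
  apply/trivIsetP => i j _ _ ij; apply/seteqP; split=> // x [/= xi xj].
  by move: ij; rewrite -xi -xj eqxx.
rewrite -DT (@ge0_integral_bigcup _ _ _ _ D)//; last by move=> x _; rewrite lee_fin.
apply: lime_le.
  by apply: is_cvg_nneseries => n _ _; apply: integral_ge0 => x _; rewrite lee_fin.
apply: nearW => N /=.
suff [r [ur _ ->]] : exists r : seq T, [/\ uniq r, {in r, forall x, (enc x < N)%N} &
    \sum_(0 <= i < N) \int[mu]_(x in D i) (F x)%:E =
    \sum_(x <- r) (F x)%:E * mu [set x]] by exact: Fb.
elim: N => [|N [r [ur rN IH]]]; first by exists [::]; rewrite big_geq// big_nil.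
rewrite big_nat_recr//= IH; have [[x xN]|nx] := pselect (exists x, enc x = N).
  exists (x :: r); split=> /=.
  - by rewrite ur andbT; apply/negP => /rN; rewrite xN ltnn.
  - by move=> y; rewrite in_cons => /predU1P[->|/rN/ltnW//]; rewrite xN.
  rewrite big_cons addeC; congr (_ + _).
  have -> : D N = [set x].
    apply/seteqP; split=> y /=; last by move=> ->.
    by move=> yN; apply: encI; rewrite xN.
  rewrite -integral_cst//; apply: eq_integral => y.
  by rewrite inE => ->.
exists r; split=> //; first by move=> x /rN/ltnW.
have -> : D N = set0 by apply/seteqP; split=> // x xN; apply: nx; exists x.
by rewrite integral_set0 adde0.
Qed.

Lemma law_le (A : set T) (b : \bar R) :
  (forall r : seq T, uniq r -> {in r, forall x, A x} ->
     \sum_(x <- r) mu [set x] <= b) -> mu A <= b.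
Proof.
move=> Ab; rewrite -[mu A]/(mu (A : set (discrete T))) -[A]setIT -integral_indic//.
apply: integral_law_le => [x|r ur]; first by rewrite indicE.
apply: (@le_trans _ _ (\sum_(x <- [seq x <- r | x \in A]) mu [set x])).
  rewrite big_filter [leRHS]big_mkcond /=; apply: lee_sum => x _.
  by rewrite indicE; case: ifP => _; rewrite ?mul1e ?mul0e.
apply: Ab; first exact: filter_uniq.
by move=> x; rewrite mem_filter => /andP[/set_mem].
Qed.

Lemma submass_law : submass predT (fun x => fine (mu [set x])).
Proof.
move=> r ur _; rewrite -lee_fin -sumEFin.
under eq_bigr => x _ do rewrite fineK ?fin_num_measure//.
by rewrite -law_seq// probability_le1.
Qed.

End CountableLaw.

(** * Laws of branching trees *)

Section Independence.
Context d (Omega : measurableType d) (R : realType) (P : probability Omega R).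
Local Open Scope ereal_scope.

Lemma ae_le (A B : set Omega) : measurable A -> measurable B ->
  {ae P, forall w, A w -> B w} -> P A <= P B.
Proof.
move=> mA mB [N [mN N0 BN]].
apply: (@le_trans _ _ (P (B `|` N))).
  rewrite le_measure ?inE//; first exact: measurableU.
  move=> w Aw; have [Bw|nBw] := pselect (B w); [by left|right].
  by apply: BN => /= /(_ Aw).
apply: le_trans (measureU2 _ mB mN) _; rewrite -[leRHS]adde0.
by apply: leeD; [exact: lexx|move/eqP: N0; rewrite eq_le => /andP[]].
Qed.

Lemma ae_imply (A B : set Omega) : (forall w, A w -> B w) ->
  {ae P, forall w, A w} -> {ae P, forall w, B w}.
Proof. by move=> AB [N [mN N0 AN]]; exists N; split=> // w nB; apply: AN => /AB. Qed.

Lemma ae_imply2 (A B D : set Omega) : (forall w, A w -> B w -> D w) ->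
  {ae P, forall w, A w} -> {ae P, forall w, B w} -> {ae P, forall w, D w}.
Proof.
move=> AB hA hB; have : P.-negligible (~` A `|` ~` B) by exact: negligibleU.
apply: negligibleS => w /= nD; rewrite -not_andP => -[Aw Bw].
by apply: nD; exact: AB.
Qed.

Lemma generated_preimage d' (T : measurableType d') (X : {mfun Omega >-> T})
  (B : set T) : measurable B -> generated X (X @^-1` B).
Proof. by move=> mB; exists B => //; rewrite setTI. Qed.

Lemma measurable_generated d' (T : measurableType d') (X : {mfun Omega >-> T})
  (A : set Omega) : generated X A -> measurable A.
Proof. by move=> [B mB <-]; exact: measurable_funP. Qed.

(** Source of the upper bounds on tree laws and on the limit law: an event that almost surely forces
    finitely many independent constraints is at most as likely as their product. *)
Lemma mutually_independent_le (I : eqType) (S : I -> set_system Omega)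
    (J : seq I) (A : I -> set Omega) (B : set Omega) :
  mutually_independent P S -> (forall i C, S i C -> measurable C) ->
  uniq J -> (forall i, i \in J -> S i (A i)) -> measurable B ->
  {ae P, forall w, B w -> forall i, i \in J -> A i w} ->
  P B <= \prod_(i <- J) P (A i).
Proof.
move=> ind mS uJ SA mB BA; rewrite -ind//; apply: ae_le => //.
by apply: fin_bigcap_measurable => // i /= iJ; apply: (mS i); exact: SA.
Qed.

End Independence.

Section TreeLaws.
Context d (Omega : measurableType d) (R : realType) (P : probability Omega R).
Context (G : typeSet).
Variables (sigma : G -> probability (discrete (seq G)) R)
          (alpha : {RV P >-> discrete G})
          (xi : seq nat -> G -> {RV P >-> discrete (seq G)}).
Hypothesis hxi : offspring_family sigma alpha xi.
Local Open Scope ereal_scope.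

Definition offspring_mass (g : G) (r : seq G) : R := fine (sigma g [set r]).
Local Notation a := offspring_mass.

Lemma offspring_mass_ge0 g r : (0 <= a g r)%R.
Proof. exact: fine_ge0. Qed.

Lemma submass_offspring g : submass predT (a g).
Proof. exact: submass_law. Qed.

(** The constraint that the event [T = t] puts on component [j]. At the addresses in [vlist] the
    default of [odflt] is never reached. *)
Let vset (t : ptree G) (j : option (seq nat * G)) : set Omega :=
  if j is Some (v, g)
  then xi v g @^-1` [set offspring (odflt t (fringe t v))]
  else alpha @^-1` [set rtype t].

Let gen (j : option (seq nat * G)) : set_system Omega :=
  if j is Some (v, g) then generated (xi v g) else generated alpha.

Let gen_vset t j : gen j (vset t j).
Proof. by case: j => [[v g]|]; apply: generated_preimage. Qed.

Let measurable_gen j A : gen j A -> measurable A.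
Proof. by case: j => [[v g]|]; exact: measurable_generated. Qed.

Let vlist (t : ptree G) (c : pred (seq nat)) : seq (option (seq nat * G)) :=
  [seq Some (v, rtype (odflt t (fringe t v))) | v <- vertices t & c v].

Let vlist_uniq t c : uniq (vlist t c).
Proof.
rewrite map_inj_uniq ?filter_uniq ?vertices_uniq//.
by move=> u v [].
Qed.

Let prod_vlist t c : \prod_(j <- vlist t c) P (vset t j) =
  (\prod_(v <- vertices t | c v)
    a (rtype (odflt t (fringe t v))) (offspring (odflt t (fringe t v))))%:E.
Proof.
rewrite big_map big_filter -prodEFin; apply: eq_bigr => v _.
have [dxi _] := hxi.
by rewrite /vset /a fineK ?fin_num_measure// -(dxi v).
Qed.

Lemma gw_tree_mass (T : {RV P >-> discrete (ptree G)}) t : gw_tree alpha xi T ->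
  distribution P T [set t] <=
  (fine (distribution P alpha [set rtype t]) * weight a t)%:E.
Proof.
move=> hT; pose J := None :: vlist t xpredT.
apply: (@le_trans _ _ (\prod_(j <- J) P (vset t j))).
  apply: (mutually_independent_le hxi.2 measurable_gen) => //.
  - rewrite /= vlist_uniq andbT; apply/negP => /mapP[]//.
  - by move=> j _; exact: gen_vset.
  - by rewrite -[_ @^-1` _]setTI; exact: measurable_funP.
  apply: ae_imply hT => w [rT gT] /= Tt; rewrite {}Tt in rT gT *;
  move=> j; rewrite in_cons => /predU1P[->|].
    by rewrite /vset /= -rT.
  move=> /mapP[v]; rewrite mem_filter mem_vertices /vertex /= => vt ->.
  by rewrite /vset /=; case: fringe (gT v) vt => //= s /(_ s erefl) <-.
rewrite /J big_cons prod_vlist EFinM fineK ?fin_num_measure//.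
Qed.

Lemma gw_tree_from_mass kappa (T : {RV P >-> discrete (ptree G)}) t :
  gw_tree_from xi kappa T -> distribution P T [set t] <= (weight a t)%:E.
Proof.
move=> hT; pose J := vlist t xpredT.
apply: (@le_trans _ _ (\prod_(j <- J) P (vset t j))).
  apply: (mutually_independent_le hxi.2 measurable_gen) => //.
  - exact: vlist_uniq.
  - by move=> j _; exact: gen_vset.
  - by rewrite -[_ @^-1` _]setTI; exact: measurable_funP.
  apply: ae_imply hT => w [rT gT] /= Tt; rewrite {}Tt in rT gT *; move=> j.
  move=> /mapP[v]; rewrite mem_filter mem_vertices /vertex /= => vt ->.
  by rewrite /vset /=; case: fringe (gT v) vt => //= s /(_ s erefl) <-.
by rewrite prod_vlist.
Qed.

Lemma gw_tree_stopped_mass kappa (T : {RV P >-> discrete (ptree G)}) t :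
  gw_tree_stopped xi kappa T ->
  distribution P T [set t] <= (blob_weight a kappa t)%:E.
Proof.
move=> hT.
pose J := vlist t (fun v => ~~ ((v != [::]) && (vtype t v == Some kappa))).
apply: (@le_trans _ _ (\prod_(j <- J) P (vset t j))).
  apply: (mutually_independent_le hxi.2 measurable_gen) => //.
  - exact: vlist_uniq.
  - by move=> j _; exact: gen_vset.
  - by rewrite -[_ @^-1` _]setTI; exact: measurable_funP.
  apply: ae_imply hT => w [rT gT] /= Tt; rewrite {}Tt in rT gT *; move=> j.
  move=> /mapP[v]; rewrite mem_filter mem_vertices /vertex /vtype /stop_at /=.
  move=> /andP[vk vt] ->; rewrite /vset /=; move: vk vt (gT v).
  by case: fringe => //= s vk _ /(_ s erefl); rewrite /stop_at (negbTE vk) => <-.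
by rewrite prod_vlist.
Qed.

Lemma gw_tree_stopped_blob kappa (T : {RV P >-> discrete (ptree G)}) :
  gw_tree_stopped xi kappa T ->
  {ae P, forall w, rtype (T w) = kappa /\ blob kappa (T w) = T w}.
Proof.
apply: ae_imply => w [rT gT]; split=> //.
case: (T w) rT gT => g s /= gk gs; rewrite /blob /=; congr Node.
apply: map_id_in => c /onthP[k kc].
have {gs} : forall v u, fringe c v = Some u -> rtype u = kappa -> children u = [::].
  move=> v u cu uk; have := gs (k :: v) u; rewrite /= kc /= => /(_ cu).
  by rewrite /stop_at /= uk eqxx; case: (children u).
elim/(@ptree_mem_ind G): c {kc} => g' s' IH cs /=.
case: eqP => [g'k|_]; first by have /= -> := cs [::] (Node g' s') erefl g'k.
congr Node; apply: map_id_in => c cs'; apply: IH => // v u cu.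
have /onthP[j jc] := cs'.
by apply: (cs (j :: v)); rewrite /= jc.
Qed.

End TreeLaws.

(** * The law of the limit tree *)

Section Spine.
Context {G : typeSet}.
Variable kappa : G.
Implicit Types (t tau : ptree G) (u v : seq nat).

Definition leaves tau : seq (seq nat) :=
  [seq u <- vertices (blob kappa tau) |
     (u != [::]) && (vtype (blob kappa tau) u == Some kappa)].

Lemma leaves_uniq tau : uniq (leaves tau).
Proof. by rewrite filter_uniq// vertices_uniq. Qed.

Lemma mem_leaves tau u :
  (u \in leaves tau) = (u != [::]) && (vtype (blob kappa tau) u == Some kappa).
Proof.
rewrite mem_filter mem_vertices /vertex /vtype; case: fringe => [s|] /=.
  by rewrite andbT.
by rewrite !andbF.
Qed.

(** Admissible values of the marked blobs. They are taken almost surely ([components_wf_ae]), after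
    which the analysis of the spine is deterministic. *)
Definition marked_blob (gamma : G) (p : ptree G * seq nat) : Prop :=
  [/\ blob kappa p.1 = p.1, rtype p.1 = kappa, p.2 != [::] &
      vtype p.1 p.2 = Some gamma].

Section Decomposition.
Variables (z : nat -> ptree G * seq nat) (c : nat -> seq nat -> ptree G).
Variable gamma : G.
Hypothesis z0 : marked_blob gamma (z 0%N).
Hypothesis zS : forall i, marked_blob kappa (z i.+1).
Hypothesis ck : forall i v, rtype (c i v) = kappa.

(** What hangs at each leaf of the blob of [u_i]: the previous piece of the spine at the mark, an
    independent copy elsewhere. In this form every level is a plain [kappa_copies] graft. *)
Let below i v : ptree G :=
  if i is j.+1 then if v == (z i).2 then (spine kappa z c j).1 else c i v
  else c i v.

Let spineE i : spine kappa z c i =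
  (graft (z i).1 (kappa_copies kappa (z i).1 (below i)),
   if i is j.+1 then (z i).2 ++ (spine kappa z c j).2 else (z i).2).
Proof.
case: i => [|i] /=; first by case: (z 0%N).
have [] := zS i; rewrite /below /=; case: (z i.+1) => t u /= _ _ u0 tu.
case: (spine kappa z c i) => t' u' /=; congr (graft t _, _).
apply/funext => v; rewrite /kappa_copies.
by case: (eqVneq v u) => [->|//]; rewrite u0 tu eqxx.
Qed.

(** The three invariants are proved together: a piece can be grafted at the next level because its
    root has type [kappa], and each level adds exactly one such root to the path. *)
Lemma spine_wf i : [/\ rtype (spine kappa z c i).1 = kappa,
  vtype (spine kappa z c i).1 (spine kappa z c i).2 = Some gamma &
  kcount kappa (spine kappa z c i).1 (spine kappa z c i).2 = i.+1].
Proof.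
elim: i => [|i [r1 v1 k1]].
  rewrite spineE; have [tK tk u0 tu] := z0.
  have vu : vertex (z 0%N).1 (z 0%N).2.
    by rewrite /vertex; move: tu; rewrite /vtype; case: fringe.
  have bk : forall v, rtype (below 0 v) = kappa by exact: ck.
  split=> /=; first by rewrite rtype_graft_blob.
    by rewrite (vtype_graft_blob tK bk).
  by rewrite (kcount_graft_blob _ tK).
have [tK tk u0 tu] := zS i; rewrite spineE /=.
have bk v : rtype (below i.+1 v) = kappa by rewrite /below; case: eqP.
have fu := fringe_graft_blob (below i.+1) tK u0 tu.
have b1 : below i.+1 (z i.+1).2 = (spine kappa z c i).1 by rewrite /below eqxx.
rewrite b1 in fu.
split; first by rewrite rtype_graft_blob.
  by rewrite /vtype fringe_cat fu /=.
rewrite (kcount_cat kappa _ fu) k1 kcount_graft_blob//.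
by rewrite /vertex; move: tu; rewrite /vtype; case: fringe.
Qed.

Let belowk i v : rtype (below i v) = kappa.
Proof.
case: i => [|i] /=; first exact: ck.
by rewrite /below; case: eqP => _ //; have [] := spine_wf i.
Qed.

Let blob_fixed i : blob kappa (z i).1 = (z i).1.
Proof. by case: i => [|i]; [have [] := z0|have [] := zS i]. Qed.

Lemma blob_spine i : blob kappa (spine kappa z c i).1 = (z i).1.
Proof. by rewrite spineE blob_graft. Qed.

Let fringe_spine i u : u \in leaves (spine kappa z c i).1 ->
  fringe (spine kappa z c i).1 u = Some (below i u).
Proof.
rewrite mem_leaves blob_spine => /andP[u0 /eqP uk].
by rewrite spineE fringe_graft_blob.
Qed.

Lemma spine0_inv :
  z 0%N = (blob kappa (spine kappa z c 0).1, (spine kappa z c 0).2) /\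
  {in leaves (spine kappa z c 0).1, forall u,
     fringe (spine kappa z c 0).1 u = Some (c 0%N u)}.
Proof.
split; last by move=> u /fringe_spine.
by rewrite blob_spine spineE; case: (z 0%N).
Qed.

(** Reads the components used at level [i.+1] off the glued tree. This turns an event about the
    spine into constraints on single components. *)
Lemma spineS_inv i (u := (z i.+1).2) : [/\ u \in leaves (spine kappa z c i.+1).1,
  z i.+1 = (blob kappa (spine kappa z c i.+1).1, u),
  (spine kappa z c i.+1).2 = u ++ (spine kappa z c i).2,
  fringe (spine kappa z c i.+1).1 u = Some (spine kappa z c i).1 &
  {in leaves (spine kappa z c i.+1).1, forall v, v != u ->
     fringe (spine kappa z c i.+1).1 v = Some (c i.+1 v)}].
Proof.
have [tK tk u0 tu] := zS i.
have ul : u \in leaves (spine kappa z c i.+1).1.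
  by rewrite mem_leaves blob_spine tu eqxx andbT.
split=> //.
- by rewrite blob_spine /u; case: (z i.+1).
- by rewrite spineE.
- by rewrite fringe_spine// /below eqxx.
- by move=> v vl vu; rewrite fringe_spine// /below (negbTE vu).
Qed.

(** The level need not be guessed: it is one less than [kcount]. Two fringe subtrees of [y] with
    roots of type [kappa] and equal counts have the same height, because the path in the higher one
    also passes through its own root. *)
Lemma spine_of_height (R : realType) (y : spine_tree G) tau v :
  (forall i, sval y (size (spine kappa z c i).2) = spine kappa z c i) ->
  rtype tau = kappa -> v != [::] -> sval y (size v) = (tau, v) ->
  spine kappa z c (kcount kappa tau v).-1 = (tau, v).
Proof.
move=> ys tk v0 yv; set i := (kcount kappa tau v).-1.
have ki : kcount kappa tau v = i.+1 by rewrite /i prednK// kcount_root.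
have [rs _ ks] := spine_wf i; have := ys i.
case: (spine kappa z c i) rs ks => t' v' /= tk' ks yv'.
have anc h h' : (h <= h')%N -> sval y h = ancestor_fringe h (sval y h').
  move=> hh'; have [vy sy _] := svalP y h'.
  have := @fringe_at_le G R h h' (Inf R y) (Fin R (exist _ (sval y h') vy)) hh'.
  by rewrite /= ancestor_fringe_id ?sy// ltnn => /(_ erefl) [].
have lt_absurd t1 v1 t2 v2 : rtype t2 = kappa -> sval y (size v1) = (t1, v1) ->
    sval y (size v2) = (t2, v2) -> (size v1 < size v2)%N ->
    kcount kappa t1 v1 = kcount kappa t2 v2 -> False.
  move=> t2k y1 y2 v12; have := anc _ _ (ltnW v12); rewrite y1 y2 /=.
  set k := (size v2 - size v1)%N => -[e1 e2].
  have k0 : (0 < k)%N by rewrite subn_gt0.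
  have v2f : vertex t2 v2 by have [+ _ _] := svalP y (size v2); rewrite y2.
  move: v2f; rewrite /vertex -{1}(cat_take_drop k v2) fringe_cat.
  case e: (fringe t2 (take k v2)) e1 => [s|] //= -> _.
  rewrite -{1}(cat_take_drop k v2) (kcount_cat kappa _ e) -e2 => /eqP.
  rewrite -[X in X == _]add0n eqn_add2r eq_sym -leqn0 leqNgt kcount_root//.
  by rewrite -size_eq0 size_takel ?leq_subr// -lt0n.
case: (ltngtP (size v) (size v')) => [vv'|vv'|vv'].
- by case: (lt_absurd tau v t' v') => //; rewrite ki ks.
- by case: (lt_absurd t' v' tau v) => //; rewrite ki ks.
- by rewrite -yv' -vv' yv.
Qed.

End Decomposition.
End Spine.

(** * Upper bounds on cylinder masses of the limit law *)

Section LimitMass.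
Context (R : realType) (G : typeSet) (kappa : G) (G0 : set G).
Context d (Omega : measurableType d) (P : probability Omega R)
  (Tkappa Tstop : {RV P >-> discrete (ptree G)}).
Context d' (Omega' : measurableType d') (P' : probability Omega' R)
  (eta : {RV P' >-> discrete G})
  (Z0 : G -> {RV P' >-> discrete (ptree G * seq nat)%type})
  (Z : nat -> {RV P' >-> discrete (ptree G * seq nat)%type})
  (C : nat -> seq nat -> {RV P' >-> discrete (ptree G)}).
Hypothesis hcomp : limit_tree_components kappa G0 Tkappa Tstop eta Z0 Z C.
Variable a : G -> seq G -> R.
Hypothesis a_ge0 : forall g r, 0 <= a g r.
Hypothesis mass_kappa :
  forall t, (distribution P Tkappa [set t] <= (weight a t)%:E)%E.
Hypothesis mass_stop :
  forall t, (distribution P Tstop [set t] <= (blob_weight a kappa t)%:E)%E.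
Hypothesis mean_pos : forall gamma, gamma \in G0 -> gamma != kappa ->
  (0 < mean_ntype gamma Tstop < +oo)%E.

Local Notation total := (fine (\esum_(g in G0) type_weight kappa Tstop g)).

Definition components_wf w : Prop :=
  [/\ eta w \in G0, marked_blob kappa (eta w) (Z0 (eta w) w),
      forall i, marked_blob kappa kappa (Z i w) &
      forall i v, rtype (C i v w : ptree G) = kappa].

Local Notation blobs w := (fun i => if i is j.+1 then Z j w else Z0 (eta w) w).
Local Notation copies w := (fun i v => C i v w).

Let component := option (G + (nat + nat * seq nat)).

Let gen (j : component) : set_system Omega' :=
  match j with
  | None => generated eta
  | Some (inl gamma) => generated (Z0 gamma)
  | Some (inr (inl i)) => generated (Z i)
  | Some (inr (inr (i, v))) => generated (C i v)
  end.

(** Index of the spine vertex at whose blob the component enters; [Z i] is rooted at [u_(i+1)],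
    hence the shift. *)
Let level (j : component) : nat :=
  match j with
  | Some (inr (inl i)) => i.+1
  | Some (inr (inr (i, _))) => i
  | _ => 0%N
  end.

Let measurable_gen j A : gen j A -> measurable A.
Proof. by case: j => [[g|[i|[i v]]]|]; exact: measurable_generated. Qed.

Let total_ge0 : 0 <= total.
Proof.
apply: fine_ge0; apply: esum_ge0 => g _; rewrite /type_weight; case: ifP => // _.
by rewrite /mean_ntype unlock; apply: integral_ge0 => w _; rewrite lee_fin.
Qed.

Let copy_mass i v t : (P' (C i v @^-1` [set t]) <= (weight a t)%:E)%E.
Proof. by have [_ _ _ hC _] := hcomp; apply: le_trans (mass_kappa t); rewrite -(hC i v). Qed.

Let blob_mass i t u : u != [::] -> vtype t u = Some kappa ->
  (P' (Z i @^-1` [set (t, u)]) <= (blob_weight a kappa t)%:E)%E.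
Proof.
move=> u0 tu; have [_ _ hZ _ _] := hcomp.
have := hZ i; rewrite /marked_blob_law eqxx => /(_ t u u0 tu) e.
by rewrite -[leLHS]/(distribution P' (Z i) [set (t, u)]) e.
Qed.

(** The weight of [gamma] in the law of [eta] cancels against the normalisation of the blob marked
    at type [gamma], leaving the same bound for all types. *)
Let base_mass gamma t u : gamma \in G0 -> u != [::] -> vtype t u = Some gamma ->
  (P' (eta @^-1` [set gamma]) * P' (Z0 gamma @^-1` [set (t, u)]) <=
   (blob_weight a kappa t / total)%:E)%E.
Proof.
move=> gG u0 tu; have [he hZ0 _ _ _] := hcomp.
rewrite -[P' (eta @^-1` _)]/(distribution P' eta [set gamma]) he//.
rewrite -[P' (Z0 _ @^-1` _)]/(distribution P' (Z0 gamma) [set (t, u)]).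
move: total_ge0; set S0 := total => S0_ge0.
have := hZ0 _ gG; rewrite /marked_blob_law /type_weight.
have pfin : distribution P Tstop [set t] \is a fin_num by exact: fin_num_measure.
have pm : fine (distribution P Tstop [set t]) <= blob_weight a kappa t.
  by rewrite -lee_fin fineK.
have [gk|gk] := eqVneq gamma kappa.
  rewrite gk in tu; move=> /(_ t u u0 tu) ->.
  rewrite -(fineK pfin) -EFinM lee_fin /= mul1r [leLHS]mulrC.
  by apply: ler_wpM2r; rewrite ?invr_ge0.
move=> /(_ t u tu) ->; rewrite -(fineK pfin) -!EFinM lee_fin.
have m0 : 0 < fine (mean_ntype gamma Tstop) by apply: fine_gt0; exact: mean_pos.
set m := fine (mean_ntype gamma Tstop) in m0 *.
have -> : m / S0 * (fine (distribution P Tstop [set t]) * m^-1) =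
    fine (distribution P Tstop [set t]) / S0.
  by rewrite mulrC mulrA divfK// gt_eqF.
by apply: ler_wpM2r; rewrite ?invr_ge0.
Qed.

(** A finite certificate that the [i]-th spine piece equals [(tau, v)] with at most the desired
    probability. The bound on levels keeps the certificate for [i] disjoint from the constraints
    added at [i.+1]. *)
Let constrained i tau v : Prop :=
  exists (J : seq component) (A : component -> set Omega'),
  [/\ uniq J, forall j, j \in J -> (level j <= i)%N,
      forall j, j \in J -> gen j (A j),
      forall w, components_wf w -> spine kappa (blobs w) (copies w) i = (tau, v) ->
        forall j, j \in J -> A j w &
      (\prod_(j <- J) P' (A j) <= (weight a tau / total)%:E)%E].

Let constrained_never i tau v :
  ~ (exists w, components_wf w /\
       spine kappa (blobs w) (copies w) i = (tau, v)) -> constrained i tau v.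
Proof.
move=> nw; exists [:: None], (fun _ => set0); split=> //.
- by move=> j; rewrite inE => /eqP ->.
- by move=> j; rewrite inE => /eqP ->; rewrite -(preimage_set0 eta); exact: generated_preimage.
- by move=> w wf ws; case: nw; exists w.
- by rewrite big_seq1 measure0 lee_fin divr_ge0// weight_ge0.
Qed.

Let weight_leaves tau : rtype tau = kappa ->
  weight a tau = blob_weight a kappa (blob kappa tau) *
    \prod_(u <- leaves kappa tau) weight a (odflt tau (fringe tau u)).
Proof. by move=> tk; rewrite (weight_blob a tk) big_filter. Qed.

Let lee_prod (I : eqType) (r : seq I) (f h : I -> \bar R) :
  {in r, forall i, (0 <= f i <= h i)%E} ->
  (0 <= \prod_(i <- r) f i <= \prod_(i <- r) h i)%E.
Proof.
move=> fh; rewrite !big_seq; apply: (big_ind2 (fun x y => (0 <= x <= y)%E)) => //.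
  by rewrite lexx andbT.
move=> x1 y1 x2 y2 /andP[? ?] /andP[? ?].
by rewrite mule_ge0//=; apply: lee_pmul.
Qed.

Let constrained0 tau v : constrained 0 tau v.
Proof.
(* One realisation [w0] supplies the type of the mark; by inversion every other realisation of the
   event has the same type and the same components. *)
have [[w0 [wf0 w0s]]|] := pselect (exists w, components_wf w /\
    spine kappa (blobs w) (copies w) 0 = (tau, v)); last exact: constrained_never.
have [eG Z0w ZSw Cw] := wf0.
have [rt vt _] := @spine_wf _ kappa (blobs w0) (copies w0) (eta w0) Z0w ZSw Cw 0.
have [zE cE] := @spine0_inv _ kappa (blobs w0) (copies w0) (eta w0) Z0w ZSw Cw.
rewrite w0s /= in rt vt zE cE.
set gamma := eta w0 in eG Z0w vt zE.
pose A (j : component) := match j with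
  | None => eta @^-1` [set gamma]
  | Some (inl _) => Z0 gamma @^-1` [set (blob kappa tau, v)]
  | Some (inr (inr (_, u))) => C 0 u @^-1` [set odflt tau (fringe tau u)]
  | _ => set0 end.
pose L : seq component := [seq Some (inr (inr (0%N, u))) | u <- leaves kappa tau].
exists [:: None, Some (inl gamma) & L], A; split.
- rewrite /= in_cons /= map_inj_uniq ?leaves_uniq//; last by move=> ? ? [].
  by rewrite andbT; apply/andP; split; apply/negP => /mapP[].
- by move=> j; rewrite !in_cons => /or3P[/eqP ->|/eqP ->|/mapP[u _ ->]].
- move=> j; rewrite !in_cons => /or3P[/eqP ->|/eqP ->|/mapP[u _ ->]];
    exact: generated_preimage.
- move=> w wf ws; have [wG wZ0 wZ wC] := wf.
  have [_ vt' _] := @spine_wf _ kappa (blobs w) (copies w) (eta w) wZ0 wZ wC 0.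
  have [zE' cE'] := @spine0_inv _ kappa (blobs w) (copies w) (eta w) wZ0 wZ wC.
  rewrite ws /= in vt' zE' cE'.
  have ew : eta w = gamma by move: vt'; rewrite vt => -[].
  move=> j; rewrite !in_cons => /or3P[/eqP ->|/eqP ->|/mapP[u ul ->]] //=.
    by rewrite -ew.
  by rewrite (cE' _ ul).
- rewrite 2!big_cons /L big_map muleA.
  rewrite (weight_leaves rt) mulrAC EFinM -prodEFin.
  have /andP[p0 pl] := @lee_prod _ (leaves kappa tau)
    (fun u => P' (A (Some (inr (inr (0%N, u))))))
    (fun u => (weight a (odflt tau (fringe tau u)))%:E)
    (fun u _ => introT andP (conj (measure_ge0 _ _) (copy_mass _ _ _))).
  apply: lee_pmul => //; first exact: mule_ge0.
  have [_ _ v0 vg] := Z0w; rewrite /= zE /= in v0 vg.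
  exact: base_mass eG v0 vg.
Qed.

Let constrainedS i tau v : (forall tau v, constrained i tau v) ->
  constrained i.+1 tau v.
Proof.
move=> IH.
have [[w0 [wf0 w0s]]|] := pselect (exists w, components_wf w /\
    spine kappa (blobs w) (copies w) i.+1 = (tau, v)); last exact: constrained_never.
have [eG Z0w ZSw Cw] := wf0.
have [rt _ _] := @spine_wf _ kappa (blobs w0) (copies w0) (eta w0) Z0w ZSw Cw i.+1.
have [ul zE vE fu cE] := @spineS_inv _ kappa (blobs w0) (copies w0) (eta w0) Z0w ZSw Cw i.
rewrite w0s [(_, _).1]/= [(_, _).2]/= in rt ul zE vE fu cE.
set u := (Z i w0).2 in ul zE vE fu cE.
(* Removing the top blob leaves the fringe subtree at its mark [u], with the rest of the address. *)
have [J' [A' [uJ' lJ' gJ' wJ' pJ']]] := IH (odflt tau (fringe tau u)) (drop (size u) v).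
pose A (j : component) := if (level j <= i)%N then A' j else match j with
  | Some (inr (inl _)) => Z i @^-1` [set (blob kappa tau, u)]
  | Some (inr (inr (_, u'))) => C i.+1 u' @^-1` [set odflt tau (fringe tau u')]
  | _ => set0 end.
pose L : seq component :=
  [seq Some (inr (inr (i.+1, u'))) | u' <- leaves kappa tau & u' != u].
have LN j : j \in L -> (level j <= i)%N = false.
  by move=> /mapP[u' _ ->] /=; rewrite ltnn.
exists (Some (inr (inl i)) :: L ++ J'), A; split.
- rewrite cons_uniq cat_uniq uJ' andbT mem_cat negb_or -!andbA.
  rewrite map_inj_uniq; last by move=> ? ? [].
  rewrite (filter_uniq _ (leaves_uniq kappa tau)).
  apply/and4P; split=> //; first by apply/negP => /mapP[].
    by apply/negP => /lJ' /=; rewrite ltnn.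
  by apply/hasPn => j /lJ' jl; apply/negP => /LN; rewrite jl.
- move=> j; rewrite in_cons mem_cat => /or3P[/eqP ->//|/mapP[u' _ ->]//|/lJ'].
  exact: leqW.
- move=> j; rewrite in_cons mem_cat /A => /or3P[/eqP -> /=|jL|jJ].
  + by rewrite ltnn; exact: generated_preimage.
  + rewrite (LN _ jL); case/mapP: jL => u' _ -> /=; exact: generated_preimage.
  + by rewrite (lJ' _ jJ); exact: gJ'.
- move=> w wf ws; have [wG wZ0 wZ wC] := wf.
  have [ul' zE' vE' fu' cE'] := @spineS_inv _ kappa (blobs w) (copies w) (eta w) wZ0 wZ wC i.
  rewrite ws [(_, _).1]/= [(_, _).2]/= in ul' zE' vE' fu' cE'.
  (* Both marks are leaves of the same blob and prefixes of [v], so they agree. *)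
  have uu : (Z i w).2 = u.
    move: ul' ul; rewrite !mem_leaves => /andP[n1 /eqP k1] /andP[n2 /eqP k2].
    exact: (fringe_leaf_prefix (blob_leaf n1 k1) (blob_leaf n2 k2)
      (etrans (esym vE') vE)).
  rewrite uu in ul' zE' vE' fu' cE'.
  move=> j; rewrite in_cons mem_cat /A => /or3P[/eqP -> /=|jL|jJ].
  + by rewrite ltnn.
  + rewrite (LN _ jL); case/mapP: jL => u'; rewrite mem_filter => /andP[u'u u'l] -> /=.
    by rewrite (cE' _ u'l u'u).
  + rewrite (lJ' _ jJ); apply: wJ' => //; rewrite fu' vE' drop_size_cat//=.
    by case: (spine _ _ _ i).
- rewrite big_cons big_cat /= /L big_map /=.
  have -> : (\prod_(j <- J') P' (A j) = \prod_(j <- J') P' (A' j))%E.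
    by apply: eq_big_seq => j jJ; rewrite /A lJ'.
  have := weight_leaves rt; rewrite (bigD1_seq u) ?leaves_uniq//= -big_filter.
  move=> ->; rewrite [X in _ * X / _]mulrC mulrA -mulrA.
  rewrite EFinM EFinM -muleA.
  have /andP[p0 pl] := @lee_prod _ [seq u' <- leaves kappa tau | u' != u]
    (fun u' => P' (C i.+1 u' @^-1` [set odflt tau (fringe tau u')]))
    (fun u' => (weight a (odflt tau (fringe tau u')))%:E)
    (fun u' _ => introT andP (conj (measure_ge0 _ _) (copy_mass _ _ _))).
  have AL : (\prod_(j <- [seq u' <- leaves kappa tau | u' != u])
      P' (A (Some (inr (inr (i.+1, j))))) =
    \prod_(u' <- [seq u' <- leaves kappa tau | u' != u])
      P' (C i.+1 u' @^-1` [set odflt tau (fringe tau u')]))%E.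
    by apply: eq_bigr => u' _; rewrite /A /= ltnn.
  rewrite prodEFin in pl; rewrite AL; apply: lee_pmul => //.
  + by apply: mule_ge0 => //; exact: prode_ge0.
  + rewrite /A /= ltnn; have [_ _ u0 uk] := ZSw i.
    by rewrite zE in uk; exact: blob_mass.
  + by apply: lee_pmul => //; exact: prode_ge0.
Qed.

Let spine_constraints i tau v : constrained i tau v.
Proof.
by elim: i tau v => [|i IH] tau v; [exact: constrained0|exact: constrainedS].
Qed.

Definition cylinder (tau : ptree G) (v : seq nat) : set (limit_space G R) :=
  [set x | fringe_at (size v) x = ((tau, v), false)].

Lemma limit_cylinder_le (That : {RV P' >-> borel (limit_space G R)}) tau v :
  limit_tree kappa eta Z0 Z C That -> {ae P', forall w, components_wf w} ->
  measurable (cylinder tau v : set (borel (limit_space G R))) ->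
  rtype tau = kappa -> v != [::] ->
  (distribution P' That (cylinder tau v) <= (weight a tau / total)%:E)%E.
Proof.
move=> hThat hwf mC tk v0.
have [J [A [uJ _ gJ wJ pJ]]] := spine_constraints (kcount kappa tau v).-1 tau v.
apply: le_trans pJ; have [_ _ _ _ ind] := hcomp.
apply: (mutually_independent_le ind measurable_gen) => //.
  by rewrite -[_ @^-1` _]setTI; exact: measurable_funP.
apply: ae_imply2 hThat hwf => w [y [yE ys]] wf; rewrite /= /cylinder /= yE /=.
move=> -[yv] j jJ; apply: wJ => //; have [_ wZ0 wZ wC] := wf.
exact: (@spine_of_height _ kappa (blobs w) (copies w) (eta w) wZ0 wZ wC R y tau v ys tk v0 yv).
Qed.

End LimitMass.

(** * Full measure of the admissible components *)

Section AlmostSure.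
Context d (Omega : measurableType d) (R : realType) (P : probability Omega R).

Lemma ae_forall_countable (I : countType) (Q : I -> Omega -> Prop) :
  (forall i, {ae P, forall w, Q i w}) -> {ae P, forall w, forall i, Q i w}.
Proof.
move=> hQ.
have h n : {ae P, forall w, if unpickle n is Some i then Q i w else True}.
  by case: (unpickle n) => [i|]; [exact: hQ|apply: aeW].
apply: ae_imply (ae_foralln h) => w Qw i.
by have := Qw (pickle i); rewrite pickleK.
Qed.

Lemma ae_preimage (T : pointedType) (X : {RV P >-> discrete T}) (A : set T) :
  (1 <= distribution P X A)%E -> {ae P, forall w, A (X w)}.
Proof.
move=> PA; exists (X @^-1` (~` A)); split=> //.
  by rewrite -[_ @^-1` _]setTI; exact: measurable_funP.
apply/eqP; rewrite -measure_le0 -[leLHS]/(distribution P X (~` A)).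
by rewrite probability_setC// sube_le0.
Qed.

End AlmostSure.

Section WellFormed.
Context (R : realType) (G : typeSet) (kappa : G) (G0 : set G).
Context d (Omega : measurableType d) (P : probability Omega R)
  (Tkappa Tstop : {RV P >-> discrete (ptree G)}).
Context d' (Omega' : measurableType d') (P' : probability Omega' R)
  (eta : {RV P' >-> discrete G})
  (Z0 : G -> {RV P' >-> discrete (ptree G * seq nat)%type})
  (Z : nat -> {RV P' >-> discrete (ptree G * seq nat)%type})
  (C : nat -> seq nat -> {RV P' >-> discrete (ptree G)}).
Hypothesis hcomp : limit_tree_components kappa G0 Tkappa Tstop eta Z0 Z C.
Hypothesis Tkappa_root : {ae P, forall w, rtype (Tkappa w : ptree G) = kappa}.
Hypothesis Tstop_blob : {ae P, forall w,
  rtype (Tstop w : ptree G) = kappa /\ blob kappa (Tstop w) = Tstop w}.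
Hypothesis mean_kappa : mean_ntype kappa Tstop = 2%:E.
Hypothesis mean_pos : forall gamma, gamma \in G0 -> gamma != kappa ->
  (0 < mean_ntype gamma Tstop < +oo)%E.
Hypothesis total_fin : (\esum_(g in G0) type_weight kappa Tstop g < +oo)%E.
Hypothesis total_pos : (0 < \esum_(g in G0) type_weight kappa Tstop g)%E.

Let pT t : R := fine (distribution P Tstop [set t]).

Let pT_ge0 t : 0 <= pT t. Proof. exact: fine_ge0. Qed.

Let pT_blob t : pT t != 0 -> rtype t = kappa /\ blob kappa t = t.
Proof.
move=> pt; apply: contrapT => nt; move/eqP: pt; apply.
rewrite /pT (_ : distribution P Tstop [set t] = 0%E)//.
have mt : measurable (Tstop @^-1` [set t]).
  by rewrite -[_ @^-1` _]setTI; exact: measurable_funP.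
have := @ae_le _ _ _ P _ set0 mt measurable0; rewrite measure0 measure_le0.
move=> h; apply/eqP/h; apply: ae_imply Tstop_blob => w; rewrite /preimage /=.
by move=> + wt; rewrite wt.
Qed.

Let marks gamma (t : ptree G) :=
  [seq u <- vertices t | (u != [::]) && (vtype t u == Some gamma)].

Let size_marks gamma t :
  ntype gamma t = ((rtype t == gamma) + size (marks gamma t))%N.
Proof.
rewrite /ntype /marks size_filter; case: t => g s.
rewrite vertices_node [LHS]/= [count _ (_ :: _) in RHS]/= add0n; congr (_ + _)%N.
by apply: eq_in_count => u /flatten_mapP[p _ /mapP[v _ ->]].
Qed.

Let marks_mass gamma (c : R) (X : {RV P' >-> discrete (ptree G * seq nat)%type})
    (r : seq (ptree G)) : uniq r ->
  (forall t u, marked_blob kappa gamma (t, u) ->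
     distribution P' X [set (t, u)] = (pT t * c)%:E) ->
  \sum_(t <- r) pT t * c * (size (marks gamma t))%:R <=
    fine (distribution P' X [set p | marked_blob kappa gamma p]).
Proof.
move=> ur hX.
have -> : \sum_(t <- r) pT t * c * (size (marks gamma t))%:R =
    \sum_(t <- [seq t <- r | pT t != 0]) pT t * c * (size (marks gamma t))%:R.
  rewrite big_filter [RHS]big_mkcond; apply: eq_bigr => t _ /=.
  by case: eqP => //= ->; rewrite !mul0r.
set r' := [seq t <- r | pT t != 0].
pose L := [seq (t, u) | t <- r', u <- marks gamma t].
have LP : {in L, forall p, marked_blob kappa gamma p}.
  move=> _ /allpairsPdep[t [u [tr um ->]]].
  move: tr um; rewrite !mem_filter => /andP[/pT_blob[tk tb] _].
  by move=> /andP[/andP[u0 /eqP uk] _].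
rewrite -lee_fin fineK ?fin_num_measure//.
have uL : uniq L.
  apply: allpairs_uniq_dep => [|t _|]; rewrite ?filter_uniq ?vertices_uniq//.
  by case=> [t u] [t' u'] _ _ /= [-> ->].
apply: le_trans (law_seq_le (distribution P' X) uL LP).
rewrite big_allpairs_dep/= -sumEFin !big_seq; apply: lee_sum => t tr.
rewrite (eq_big_seq (fun=> (pT t * c)%:E)); last first.
  by move=> u um; apply: hX; apply: LP; apply/allpairsPdep; exists t, u.
rewrite sumEFin big_const_seq iter_addr_0 count_predT mulr_natr.
by [].
Qed.

Let mean_law gamma : mean_ntype gamma Tstop =
  (\int[distribution P Tstop]_t ((ntype gamma t)%:R : R)%:E)%E.
Proof.
by rewrite ge0_integral_distribution// /mean_ntype unlock.
Qed.

Let pTE t : distribution P Tstop [set t] = (pT t)%:E.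
Proof. by rewrite fineK// fin_num_measure. Qed.

(** The blob law prescribes point masses only at admissible points. These add up to the mean number
    of non-root [kappa] vertices, which is 2 - 1 = 1 after discarding the root, so no mass is left
    for other points. *)
Let blob_ae (X : {RV P' >-> discrete (ptree G * seq nat)%type}) :
  marked_blob_law kappa Tstop kappa X ->
  {ae P', forall w, marked_blob kappa kappa (X w)}.
Proof.
rewrite /marked_blob_law eqxx => hX.
apply: (@ae_preimage _ _ _ _ _ X [set p | marked_blob kappa kappa p]).
set x := distribution P' X _.
have xE : x = (fine x)%:E by rewrite fineK// fin_num_measure.
have : (mean_ntype kappa Tstop <= (fine x + 1)%:E)%E.
  rewrite mean_law; apply: (@integral_law_le (ptree G) _ _ pickle (pcan_inj pickleK)) => //.
  move=> r ur; rewrite (eq_bigr (fun t => ((ntype kappa t)%:R * pT t)%:E)); last first.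
    by move=> t _; rewrite EFinM; congr (_ * _)%E; exact: pTE.
  rewrite sumEFin lee_fin.
  apply: (@le_trans _ _ (\sum_(t <- r) (pT t * 1 * (size (marks kappa t))%:R + pT t))).
    apply: ler_sum => t _; have [->|/pT_blob[tk _]] := eqVneq (pT t) 0.
      by rewrite mulr0 !mul0r addr0.
    by rewrite size_marks tk eqxx mulr1 natrD mulrDl mul1r addrC mulrC.
  rewrite big_split /= lerD//.
    apply: marks_mass => // t u [_ _ u0 uk].
    by rewrite (hX t u u0 uk) mulr1 pTE.
  exact: (submass_law (distribution P Tstop)).
by rewrite mean_kappa xE !lee_fin; lra.
Qed.

Let base_ae gamma : gamma \in G0 -> gamma != kappa ->
  marked_blob_law kappa Tstop gamma (Z0 gamma) ->
  {ae P', forall w, marked_blob kappa gamma (Z0 gamma w)}.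
Proof.
move=> gG gk; rewrite /marked_blob_law (negbTE gk) => hX.
apply: (@ae_preimage _ _ _ _ _ (Z0 gamma) [set p | marked_blob kappa gamma p]).
set x := distribution P' _ _.
have xE : x = (fine x)%:E by rewrite fineK// fin_num_measure.
have /andP[m0 moo] := mean_pos gG gk.
have mE : mean_ntype gamma Tstop = (fine (mean_ntype gamma Tstop))%:E.
  by rewrite fineK// ge0_fin_numE// ltW.
rewrite mE lte_fin in m0; set m := fine _ in mE m0 hX.
have : (mean_ntype gamma Tstop <= (m * fine x)%:E)%E.
  rewrite mean_law; apply: (@integral_law_le (ptree G) _ _ pickle (pcan_inj pickleK)) => //.
  move=> r ur; rewrite (eq_bigr (fun t => ((ntype gamma t)%:R * pT t)%:E)); last first.
    by move=> t _; rewrite EFinM; congr (_ * _)%E; exact: pTE.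
  rewrite sumEFin lee_fin.
  apply: (@le_trans _ _ (m * \sum_(t <- r) (pT t * m^-1 * (size (marks gamma t))%:R))).
    rewrite mulr_sumr; apply: ler_sum => t _.
    have [->|/pT_blob[tk _]] := eqVneq (pT t) 0; first by rewrite !(mulr0, mul0r).
    rewrite size_marks tk [kappa == _]eq_sym (negbTE gk) add0n.
    by rewrite mulrA mulrCA mulfV ?gt_eqF// mulr1 mulrC.
  rewrite ler_pM2l//; apply: marks_mass => // t u [_ _ u0 uk].
  by rewrite (hX t u uk) pTE.
by rewrite mE xE !lee_fin ler_pMr.
Qed.

(** The point masses prescribed on [G0] already sum to one, since the total weight is finite and
    positive. *)
Let eta_ae : {ae P', forall w, eta w \in G0}.
Proof.
have [he _ _ _ _] := hcomp.
have := @ae_preimage _ _ _ P' _ eta G0.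
suff H : (1 <= distribution P' eta G0)%E.
  by move=> /(_ H); apply: ae_imply => w; exact: mem_set.
set x := distribution P' eta G0.
have xE : x = (fine x)%:E by rewrite fineK// fin_num_measure.
have Sfin := total_fin; have Spos := total_pos.
set S := (\esum_(g in G0) type_weight kappa Tstop g)%E in Sfin Spos he *.
have SE : S = (fine S)%:E by rewrite fineK// ge0_fin_numE// ltW.
have S0 : 0 < fine S by rewrite -lte_fin -SE.
have : (S <= (fine S * fine x)%:E)%E.
  apply: ge_ereal_sup => _ [A [finA AG] <-].
  have [r0 rA] := (finite_seqP A).1 finA.
  have {r0 rA}[r [ur rA]] : exists r : seq G, uniq r /\ A = [set` r].
    exists (undup r0); split; first exact: undup_uniq.
    by rewrite rA; apply/seteqP; split=> g /=; rewrite mem_undup.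
  have rG : {in r, forall g, G0 g} by move=> g gr; apply: AG; rewrite rA.
  rewrite rA -fsbig_seq//.
  have h : (\sum_(g <- r) distribution P' eta [set g] <= (fine x)%:E)%E.
    by rewrite -xE; exact: law_seq_le.
  rewrite (eq_big_seq (fun g => (fine (type_weight kappa Tstop g))%:E)); last first.
    move=> g /rG gG; rewrite /type_weight; case: (eqVneq g kappa) => // gk.
    have /andP[m0 moo] := mean_pos (mem_set gG) gk.
    by rewrite fineK// ge0_fin_numE// ltW.
  move: h; rewrite (eq_big_seq (fun g => (fine (type_weight kappa Tstop g) / fine S)%:E));
    last by move=> g /rG gG; apply: he; exact: mem_set.
  rewrite !sumEFin !lee_fin -mulr_suml ler_pdivrMr//.
  by rewrite mulrC.
by rewrite SE xE !lee_fin ler_pMr.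
Qed.

Lemma components_wf_ae : {ae P', forall w, components_wf kappa G0 eta Z0 Z C w}.
Proof.
have [_ hZ0 hZ hC _] := hcomp.
have aZ0 : {ae P', forall w, forall gamma, gamma \in G0 ->
    marked_blob kappa gamma (Z0 gamma w)}.
  apply: ae_forall_countable => gamma.
  have [gG|gG] := boolP (gamma \in G0); last by apply: aeW.
  have [gk|gk] := eqVneq gamma kappa.
    have h : marked_blob_law kappa Tstop kappa (Z0 gamma).
      by move: (hZ0 _ gG); rewrite gk.
    have E : marked_blob kappa gamma = marked_blob kappa kappa by rewrite gk.
    by rewrite E; apply: ae_imply (blob_ae h).
  by apply: ae_imply (base_ae gG gk (hZ0 _ gG)).
have aZ : {ae P', forall w, forall i, marked_blob kappa kappa (Z i w)}.
  by apply: ae_forall_countable => i; exact: blob_ae.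
have aC : {ae P', forall w, forall p : nat * seq nat,
    rtype (C p.1 p.2 w : ptree G) = kappa}.
  apply: ae_forall_countable => -[i v] /=.
  apply: (@ae_preimage _ _ _ _ _ (C i v) [set t | rtype t = kappa]).
  rewrite hC -(probability_setT P); apply: ae_le => //.
    by rewrite -[_ @^-1` _]setTI; exact: measurable_funP.
  by apply: ae_imply Tkappa_root.
apply: ae_imply2 (ae_imply2 _ aZ aC) (ae_imply2 _ aZ0 eta_ae); last 2 first.
- by move=> w h1 h2; exact: (conj h1 h2).
- by move=> w h1 h2; exact: (conj h1 h2).
move=> w [wZ wC] [wZ0 we]; split=> //; first exact: wZ0.
by move=> i v; exact: (wC (i, v)).
Qed.

End WellFormed.

(** * The empirical fringe law *)

Lemma natr_count (R : pzSemiRingType) (T : Type) (a : pred T) (r : seq T) :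
  (count a r)%:R = \sum_(x <- r) (a x)%:R :> R.
Proof.
rewrite -sum1_count big_mkcond natr_sum; apply: eq_bigr => x _.
by case: (a x).
Qed.

Section FringeLaw.
Context (R : realType) (G : typeSet) (G0 : set G).
Implicit Types t tau : ptree G.

Let in_G0 t v : bool := if vtype t v is Some g then g \in G0 else false.

Definition marked_count t : nat := count (in_G0 t) (vertices t).

Lemma val_marked_in t :
  [seq val p | p <- marked_in G0 t] = [seq (t, v) | v <- vertices t & in_G0 t v].
Proof.
rewrite /marked_in (pmap_filter (insubK _)); apply/all_filterP/allP => p.
move=> /mapP[v]; rewrite mem_filter mem_vertices => /andP[_ vt] ->.
by rewrite /= insubT.
Qed.

Lemma size_marked_in t : size (marked_in G0 t) = marked_count t.
Proof. by rewrite -(size_map val) val_marked_in size_map size_filter. Qed.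

Lemma esum_ntype t :
  (\esum_(gamma in G0) (ntype gamma t)%:R%:E = (marked_count t)%:R%:E :> \bar R)%E.
Proof.
have nE gamma : ((ntype gamma t)%:R%:E =
    \sum_(v <- vertices t) (vtype t v == Some gamma)%:R%:E :> \bar R)%E.
  by rewrite sumEFin -natr_count.
under eq_esum do rewrite nE.
rewrite esum_sum//.
rewrite /marked_count natr_count -sumEFin; apply: eq_bigr => v _.
rewrite /in_G0; case: (vtype t v) => [g|]; last first.
  by rewrite esum1// => g _; case: eqP.
rewrite esum_mkcond (_ : (fun g' => _) =
    fun g' => if g' \in [set g] then ((g \in G0)%:R)%:E else 0%E).
  by rewrite -esum_mkcond esum_set1// lee_fin.
apply/funext => g'; rewrite in_set1 -[Some g == _]/(g == g') eq_sym.
by have [->|] := eqVneq g' g; case: ifP.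
Qed.

Variable mu0 : ptree G -> probability (borel (limit_space G R)) R.

Lemma fringe_lawE t (B : set (borel (limit_space G R))) :
  (0 < marked_count t)%N ->
  fringe_law G0 mu0 t B =
  ((count (fun p => Fin R p \in B) (marked_in G0 t))%:R / (marked_count t)%:R)%:E.
Proof.
rewrite /fringe_law -size_marked_in => n0.
pose s : seq (borel (limit_space G R)) := [seq Fin R p | p <- marked_in G0 t].
rewrite -[fringe_law _ _ _ _]/(mnormalize (msum (fun i => \d_(nth point s i)) (size s)) (mu0 t) B).
have sE (A : set (borel (limit_space G R))) :
    (msum (fun i => \d_(nth point s i)) (size s) A =
     (count (fun x => x \in A) s)%:R%:E :> \bar R)%E.
  rewrite /msum /= natr_count -sumEFin.
  rewrite -(big_mkord xpredT (fun i => \d_(nth point s i) A)).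
  rewrite -(big_nth point xpredT (fun x => \d_x A)).
  by apply: eq_bigr => x _; rewrite diracE.
rewrite /mnormalize /= !sE.
have -> : count (fun x => x \in [set: borel (limit_space G R)]) s = size (marked_in G0 t).
  by rewrite -(size_map (Fin R)); apply/eqP; rewrite -all_count; apply/allP => x _; rewrite inE.
rewrite eqe pnatr_eq0 (gtn_eqF n0) /= sE -EFinM; congr (_ / _)%:E.
by rewrite /s count_map.
Qed.

(** Each occurrence [y] of [tau] yields the marked vertex [y ++ v], and different occurrences yield
    different vertices. *)
Lemma fringe_count_le tau v t : v != [::] -> in_G0 tau v ->
  (fringe_count tau t <=
   count (fun p => Fin R p \in cylinder (R := R) tau v) (marked_in G0 t))%N.
Proof.
move=> v0 tv; set Q := fun p => _.
pose Q' (p : ptree G * seq nat) := (ancestor_fringe (size v) p == (tau, v)) &&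
  ~~ (size p.2 < size v)%N.
have -> : count Q (marked_in G0 t) = count Q' [seq val p | p <- marked_in G0 t].
  rewrite count_map; apply: eq_count => p; rewrite /Q /Q' /=; apply/idP/idP.
    by rewrite inE /cylinder /= => -[-> ->]; rewrite eqxx.
  move=> /andP[/eqP e1 /negbTE e2]; rewrite inE /cylinder /=.
  by rewrite e1 e2.
rewrite val_marked_in count_map -size_filter /fringe_count -size_filter.
rewrite -(size_map (fun y => y ++ v)); apply: uniq_leq_size.
  rewrite map_inj_uniq ?filter_uniq ?vertices_uniq//.
  move=> y y' e; have /addIn sz : (size y + size v = size y' + size v)%N.
    by rewrite -!size_cat e.
  by move/eqP: e; rewrite eqseq_cat// => /andP[/eqP].
move=> _ /mapP[y + ->]; rewrite mem_filter => /andP[/eqP yt _].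
have yv : fringe t (y ++ v) = fringe tau v by rewrite fringe_cat yt.
rewrite !mem_filter mem_vertices /Q' /= size_cat addnK take_size_cat// drop_size_cat//.
rewrite yt eqxx /= -leqNgt leq_addl /=.
move: tv; rewrite /in_G0 /vtype /vertex yv; case: fringe => //= u ->.
by [].
Qed.

Lemma fringe_law_cylinder tau v t : (0 < marked_count t)%N ->
  v != [::] -> in_G0 tau v ->
  (((fringe_count tau t)%:R / (marked_count t)%:R)%:E <=
   fringe_law G0 mu0 t (cylinder (R := R) tau v))%E.
Proof.
move=> n0 v0 tv; rewrite fringe_lawE// lee_fin ler_wpM2r ?invr_ge0//.
by rewrite ler_nat fringe_count_le.
Qed.

End FringeLaw.

(** * Weak convergence on the space of marked trees *)

Section StepIntegral.
Context d (T : measurableType d) (R : realType).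
Local Open Scope ereal_scope.

(** Error budget: [2 * e] for the oscillation of [g] on the cells, one [B * e] for the [l]-mass
    outside the first [n] cells, and another for the [n] mass deficits [eta]. *)
Lemma integral_step_le (l mu : probability T R) (g : T -> R) (B e eta : R)
    (F : nat -> set T) (b : nat -> R) (n : nat) :
  measurable_fun setT g -> (forall x, (0 <= g x <= B)%R) ->
  (forall i, measurable (F i)) -> trivIset setT F ->
  (forall i, (0 <= b i <= B)%R) -> (0 <= e)%R -> (0 <= eta)%R ->
  (n%:R * eta <= e)%R ->
  (forall i x, F i x -> (b i <= g x <= b i + 2 * e)%R) ->
  (1 - e <= \sum_(i < n) fine (l (F i)))%R ->
  (forall i, (i < n)%N -> (fine (l (F i)) - eta <= fine (mu (F i)))%R) ->
  \int[l]_x (g x)%:E <= \int[mu]_x (g x)%:E + (2 * e + 2 * (B * e))%:E.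
Proof.
move=> mg gB mF tF bB e0 eta0 neta bg le1 lmu.
have mgE (D : set T) : measurable D -> measurable_fun D (EFin \o g).
  by move=> mD; apply/measurable_EFinP; exact: measurable_funTS.
pose U := \big[setU/set0]_(i < n) F i.
have mU : measurable U by exact: bigsetU_measurable.
have B0 : (0 <= B)%R by have /andP[b0 b1] := bB 0%N; exact: le_trans b1.
have split (nu : probability T R) :
    \int[nu]_x (g x)%:E = \sum_(i < n) \int[nu]_(x in F i) (g x)%:E +
                          \int[nu]_(x in ~` U) (g x)%:E.
  have -> : \sum_(i < n) \int[nu]_(x in F i) (g x)%:E = \int[nu]_(x in U) (g x)%:E.
    rewrite -(big_mkord xpredT (fun i => \int[nu]_(x in F i) (g x)%:E)).
    rewrite -ge0_integral_bigsetU ?iota_uniq//.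
    - by rewrite /U big_mkord.
    - exact: (@sub_trivIset _ _ _ setT).
    - by apply: mgE; exact: bigsetU_measurable.
    - by move=> x _; rewrite lee_fin; have /andP[] := gB x.
  rewrite -ge0_integral_setU ?setUv//; first exact: measurableC.
  - exact: mgE.
  - by move=> x _; rewrite lee_fin; have /andP[] := gB x.
  - by apply/disj_setPCl.
have lU : l (~` U) <= e%:E.
  rewrite probability_setC//; have -> : l U = (\sum_(i < n) fine (l (F i)))%:E.
    rewrite /U measure_bigsetU// -sumEFin; apply: eq_bigr => i _.
    by rewrite fineK// fin_num_measure.
  by rewrite -EFinB lee_fin lerBlDr -lerBlDl.
apply: (@le_trans _ _ ((\sum_(i < n) ((b i + 2 * e) * fine (l (F i))) + B * e)%:E)).
  rewrite split EFinD -sumEFin; apply: leeD.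
    apply: lee_sum => i _; apply: (@le_trans _ _ (\int[l]_(x in F i) (b i + 2 * e)%:E)).
      apply: ge0_le_integral => //.
      - by move=> x _; rewrite lee_fin; have /andP[] := gB x.
      - exact: mgE.
      - by move=> x Fx; rewrite lee_fin; have /andP[] := bg i x Fx.
    by rewrite integral_cst// EFinM fineK// fin_num_measure.
  apply: (@le_trans _ _ (\int[l]_(x in ~` U) B%:E)).
    apply: ge0_le_integral => //; first exact: measurableC.
    - by move=> x _; rewrite lee_fin; have /andP[] := gB x.
    - by apply: mgE; exact: measurableC.
    - by move=> x _; rewrite lee_fin; have /andP[] := gB x.
  rewrite integral_cst ?EFinM; last exact: measurableC.
  by rewrite lee_pmul// measure_ge0.
apply: (@le_trans _ _ ((\sum_(i < n) b i * fine (mu (F i)) +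
    (2 * e + 2 * (B * e)))%:E)); last first.
  rewrite EFinD leeD// split -[leLHS]adde0; apply: leeD; last first.
    by apply: integral_ge0 => x _; rewrite lee_fin; have /andP[] := gB x.
  rewrite -sumEFin; apply: lee_sum => i _.
  apply: (@le_trans _ _ (\int[mu]_(x in F i) (b i)%:E)).
    by rewrite integral_cst// EFinM fineK// fin_num_measure.
  apply: ge0_le_integral => //.
  - by move=> x _; rewrite lee_fin; have /andP[] := bB i.
  - exact: mgE.
  - by move=> x Fx; rewrite lee_fin; have /andP[] := bg i x Fx.
rewrite lee_fin.
have s1 : (\sum_(i < n) fine (l (F i)) <= 1)%R.
  rewrite -lee_fin -sumEFin; under eq_bigr do rewrite fineK ?fin_num_measure//.
  by rewrite -measure_bigsetU// probability_le1.
have s2 : (\sum_(i < n) b i * fine (l (F i)) <=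
    \sum_(i < n) b i * fine (mu (F i)) + B * e)%R.
  apply: (@le_trans _ _ (\sum_(i < n) (b i * fine (mu (F i)) + B * eta))%R).
    apply: ler_sum => i _; have /andP[b0 b1] := bB i.
    have := lmu i (ltn_ord i); rewrite lerBlDr => h.
    apply: (@le_trans _ _ (b i * (fine (mu (F i)) + eta))%R); first exact: ler_wpM2l.
    by rewrite mulrDr lerD2l; exact: ler_wpM2r.
  rewrite big_split/= lerD2l sumr_const card_ord -mulr_natl mulrCA.
  exact: ler_wpM2l.
have -> : (\sum_(i < n) (b i + 2 * e) * fine (l (F i)) =
    \sum_(i < n) b i * fine (l (F i)) + 2 * e * \sum_(i < n) fine (l (F i)))%R.
  by rewrite mulr_sumr -big_split/=; apply: eq_bigr => i _; rewrite mulrDl.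
have s3 : (2 * e * \sum_(i < n) fine (l (F i)) <= 2 * e)%R.
  by rewrite ler_piMr// mulr_ge0.
lra.
Qed.

End StepIntegral.

Section LimitSpaceTopology.
Context (G : typeSet) (R : realType).
Local Notation X := (limit_space G R).
Implicit Types x y : X.

Let agree x y : set (\bar R) :=
  [set h%:R%:E | h in [set h : nat | fringe_at h x = fringe_at h y]].

Lemma dist_ge x y h : fringe_at h x <> fringe_at h y -> 2 `^ (- h%:R) <= dist x y.
Proof.
move=> xyh; rewrite /dist; case: asboolP => [xy0|_]; last first.
  apply: (@le_trans _ _ 1); last by rewrite ler1n.
  by rewrite -[leRHS](powRr0 2) ler_powR ?ler1n// oppr_le0 ler0n.
have s1 : (ereal_sup (agree x y) <= h%:R%:E)%E.
  apply: ge_ereal_sup => _ [m /= xym <-]; rewrite lee_fin ler_nat leqNgt.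
  by apply/negP => /ltnW/fringe_at_le /(_ xym).
have s0 : (0%:E <= ereal_sup (agree x y))%E by apply: ereal_sup_ubound; exists 0%N.
move: s0 s1; rewrite -/(agree x y); case: ereal_sup => //= r _ rh.
by rewrite ler_powR ?ler1n// lerN2 -lee_fin.
Qed.

Lemma dist_le x y h : fringe_at h x = fringe_at h y -> dist x y <= 2 `^ (- h%:R).
Proof.
move=> xyh; rewrite /dist; case: asboolP => [_|]; last first.
  by case; exact: fringe_at_le xyh.
have : (h%:R%:E <= ereal_sup (agree x y))%E by apply: ereal_sup_ubound; exists h.
rewrite -/(agree x y); case: ereal_sup => //= r.
by rewrite lee_fin => hr; rewrite ler_powR ?ler1n// lerN2.
Qed.

Lemma open_fringe_at h (A : set ((ptree G * seq nat) * bool)) :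
  open [set x : X | A (fringe_at h x)].
Proof.
rewrite openE => x /= Ax; rewrite /interior -nbhs_ballE.
exists (2 `^ (- h%:R)); first by rewrite /= powR_gt0.
move=> y; rewrite ballEmdist /= => xy.
suff -> : fringe_at h y = fringe_at h x by [].
apply: contrapT => /nesym/dist_ge; rewrite leNgt => /negP; exact.
Qed.

Lemma measurable_fringe_at h (A : set ((ptree G * seq nat) * bool)) :
  measurable ([set x | A (fringe_at h x)] : set (borel X)).
Proof. by apply: sub_sigma_algebra; exact: open_fringe_at. Qed.

Lemma continuous_fringe_at (f : X -> R^o) x e : continuous f -> 0 < e ->
  exists h, forall y, fringe_at h x = fringe_at h y -> `|f x - f y| < e.
Proof.
move=> /(_ x)/cvgrPdist_lt /(_ e) + e0 => /(_ e0).
rewrite -nbhs_ballE => -[r /= r0 xr].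
(* Then [2 ^ (-h) < 1 / h < r]. *)
pose h := (Num.truncn r^-1).+1; exists h => y xy.
apply: xr; rewrite ballEmdist /=; apply: le_lt_trans (dist_le xy) _.
rewrite powRN powR_mulrn ?ler0n// invf_plt ?posrE ?exprn_gt0//.
apply: lt_trans (_ : h%:R < _); first by rewrite truncnS_gt.
by rewrite -natrX ltr_nat ltn_expl.
Qed.

Lemma measurable_continuous (f : X -> R^o) : continuous f ->
  measurable_fun setT (f : borel X -> R).
Proof.
move=> cf; apply: (measurability _ (RGenOInfty.measurableE R)) => //.
move=> _ [_ [a ->] <-]; rewrite setTI; apply: sub_sigma_algebra.
rewrite /=; apply: open_comp; last exact: rray_open.
by move=> x _; exact: cf.
Qed.

End LimitSpaceTopology.

Section Portmanteau.
Context (G : typeSet) (R : realType).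
Local Notation X := (limit_space G R).
Local Notation cyl p := (cylinder (R := R) p.1 p.2).

Lemma measurable_cylinder (tau : ptree G) v :
  measurable (cylinder tau v : set (borel X)).
Proof. exact: (measurable_fringe_at (size v) [set ((tau, v), false)]). Qed.

Context d (Omega : measurableType d) (P : probability Omega R)
  (That : {RV P >-> borel X}).
(** The cylinders whose masses can be estimated. In the application their trees are rooted at type
    [kappa], so not every depth is available, only arbitrarily large ones. *)
Variable K : set (ptree G * seq nat).
Hypothesis K_deep : {ae P, forall w, forall H : nat, exists p,
  [/\ K p, (H <= size p.2)%N & cyl p (That w)]}.
Local Notation l := (distribution P That).

Section Lower.
Variables (g : X -> R^o) (B e : R).
Hypotheses (cg : continuous g) (gB : forall x, 0 <= g x <= B) (e0 : 0 < e).

Let flat p : Prop := K p /\ forall x y : X, cyl p x -> cyl p y -> `|g x - g y| <= e.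

(* Maximal cylinders of oscillation at most [e]: they are pairwise disjoint
   because two cylinders are either nested or disjoint. *)
Let maximal p : Prop := flat p /\ forall q, flat q -> (size q.2 < size p.2)%N ->
  forall x : X, cyl p x -> ~ cyl q x.

Let maximal_eq p q (x : X) : maximal p -> maximal q -> cyl p x -> cyl q x -> p = q.
Proof.
move=> [fp mp] [fq mq] px qx; case: (ltngtP (size p.2) (size q.2)) => pq.
- by case: (mq p fp pq x qx).
- by case: (mp q fq pq x px).
move: px qx; rewrite /cylinder /= pq => -> [].
by case: p q {fp mp fq mq pq} => ? ? [? ?] /= -> ->.
Qed.

(** Take a flat cylinder through [x] of least depth; by nesting, any shallower flat cylinder meeting
    it would contain [x] too. *)
Let maximal_cover p (x : X) : flat p -> cyl p x -> exists2 q, maximal q & cyl q x.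
Proof.
move=> fp px.
have ex : exists n, `[< exists q, [/\ flat q, cyl q x & size q.2 = n] >].
  by exists (size p.2); apply/asboolP; exists p.
case: (ex_minnP ex) => n /asboolP[q [fq qx sq]] nmin.
exists q => //; split=> // r fr rq y qy ry.
have : cyl r x.
  move: qx qy ry; rewrite /cylinder /= => qx qy <-.
  by apply: fringe_at_le (ltnW rq) _; rewrite qx qy.
move=> rx; have : (n <= size r.2)%N by apply: nmin; apply/asboolP; exists r.
by rewrite leqNgt -sq rq.
Qed.

Let F (n : nat) : set (borel X) :=
  if pickle_inv n is Some p then (if `[< maximal p >] then cyl p else set0) else set0.

Let F_cyl n x : F n x -> exists p, [/\ pickle p = n, maximal p & F n = cyl p].
Proof.
rewrite /F; case e1: pickle_inv => [p|//].
case: asboolP => // mp _; exists p; split=> //.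
by have := @pickle_invK (ptree G * seq nat)%type n; rewrite e1.
Qed.

Let measurable_F n : measurable (F n).
Proof.
rewrite /F; case: pickle_inv => [p|]; last exact: measurable0.
by case: ifP => _; [exact: measurable_cylinder|exact: measurable0].
Qed.

Let trivIset_F : trivIset setT F.
Proof.
apply/trivIsetP => i j _ _ ij; apply/seteqP; split=> // x [ix jx].
have [p [pi mp Fp]] := F_cyl ix; have [q [qj mq Fq]] := F_cyl jx.
rewrite Fp in ix; rewrite Fq in jx.
by move/eqP: ij; apply; rewrite -pi -qj (maximal_eq mp mq ix jx).
Qed.

Let F_full : (1 <= \sum_(i <oo) l (F i))%E.
Proof.
have -> : (\sum_(i <oo) l (F i) = l (\bigcup_i F i))%E.
  by rewrite measure_semi_bigcup//; exact: bigcup_measurable.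
rewrite -(probability_setT P); apply: ae_le => //.
  rewrite -[_ @^-1` _]setTI; apply: measurable_funP => //.
  exact: bigcup_measurable.
apply: ae_imply K_deep => w Kw _.
have e2 : 0 < e / 2 by rewrite divr_gt0.
have [h xh] := continuous_fringe_at (That w) cg e2.
have [p [Kp hp pw]] := Kw h.
have fp : flat p.
  have close y : cyl p y -> `|g (That w) - g y| < e / 2.
    move=> py; apply: xh; apply: fringe_at_le hp _.
    by move: pw py; rewrite /cylinder /= => -> ->.
  split=> // x y px py; rewrite (splitr e).
  rewrite -(subrK (g (That w)) (g x)) -addrA (le_trans (ler_normD _ _))// lerD//.
    by rewrite distrC ltW// close.
  by rewrite ltW// close.
have [q mq qw] := maximal_cover fp pw.
exists (pickle q) => //; rewrite /F pickleK_inv.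
by case: asboolP.
Qed.

Let F_finite : exists n, 1 - e <= \sum_(i < n) fine (l (F i)).
Proof.
apply: contrapT => /forallNP Fn.
have : (\sum_(i <oo) l (F i) <= (1 - e)%:E)%E.
  apply: lime_le; first by apply: is_cvg_nneseries => n _ _; exact: measure_ge0.
  apply: nearW => n; have /negP := Fn n; rewrite -ltNge => /ltW.
  rewrite -lee_fin -sumEFin big_mkord; apply: le_trans; apply: lee_sum => i _.
  by rewrite fineK// fin_num_measure.
move=> /(le_trans F_full); rewrite lee_fin lerBrDr gerDl.
by rewrite leNgt e0.
Qed.

(** The value at a chosen point of the cell, lowered by the oscillation [e], lies below [g] on the
    cell by at most [2 * e]. The maximum with 0 keeps the step function nonnegative. *)
Let lower n : R := if pselect (exists x, F n x) is left h
  then Num.max 0 (g (projT1 (cid h)) - e) else 0.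

Let lower_bounds n : 0 <= lower n <= B.
Proof.
have B0 : 0 <= B by have /andP[] := gB point; exact: le_trans.
rewrite /lower; case: pselect => [h|_]; last by rewrite lexx.
rewrite le_max lexx /= ge_max B0 /=; have /andP[_ gB'] := gB (projT1 (cid h)).
by rewrite lerBlDr (le_trans gB')// lerDl ltW.
Qed.

Let lower_spec n x : F n x -> lower n <= g x <= lower n + 2 * e.
Proof.
move=> Fx; rewrite /lower; case: pselect => [h|[]]; last by exists x.
case: (cid h) => y /= Fy; have [p [_ [[_ fp] _] Fp]] := F_cyl Fx.
rewrite Fp in Fx Fy; have /andP[g0 _] := gB x.
have := fp _ _ Fx Fy; rewrite ler_norml => /andP[h1 h2].
rewrite ge_max g0 /=; apply/andP; split; first by lra.
have : g y - e <= Num.max 0 (g y - e) by rewrite le_max lexx orbT.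
lra.
Qed.

Lemma portmanteau_lower : exists (D : seq (ptree G * seq nat)) (eta : R),
  [/\ 0 < eta, {in D, forall p, K p} &
      forall mu : probability (borel X) R,
        (forall p, p \in D -> fine (l (cyl p)) - eta <= fine (mu (cyl p))) ->
        (\int[l]_x (g x)%:E <= \int[mu]_x (g x)%:E + (2 * e + 2 * (B * e))%:E)%E].
Proof.
(* The successor keeps [eta] positive for [n = 0] and still gives [n * eta <= e]. *)
have [n Fn] := F_finite; pose eta := e / n.+1%:R.
have eta0 : 0 < eta by rewrite divr_gt0.
exists [seq p <- pmap pickle_inv (iota 0 n) | `[< maximal p >]], eta; split=> //.
  by move=> p; rewrite mem_filter => /andP[/asboolP[[]]].
move=> mu lmu; apply: (@integral_step_le _ _ _ l mu g B e eta F lower n) => //.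
- exact: measurable_continuous.
- exact: ltW.
- exact: ltW.
- rewrite /eta mulrCA; apply: ler_piMr; first exact: ltW.
  by rewrite ler_pdivrMr// mul1r ler_nat.
- move=> i ni; have [[x Fx]|nF] := pselect (exists x, F i x).
    have [p [pi mp Fp]] := F_cyl Fx; rewrite Fp; apply: lmu.
    rewrite mem_filter; apply/andP; split; first exact/asboolP.
    rewrite mem_pmap; apply/mapP; exists i; first by rewrite mem_iota.
    by rewrite -pi pickleK_inv.
  have -> : F i = set0 by apply/seteqP; split=> // x Fx; apply: nF; exists x.
  by rewrite !measure0 /= sub0r oppr_le0 ltW.
Qed.

End Lower.

Lemma portmanteau (f : bounded_continuous R X) (e : R) : 0 < e ->
  exists (D : seq (ptree G * seq nat)) (eta : R),
  [/\ 0 < eta, {in D, forall p, K p} &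
      forall mu : probability (borel X) R,
        (forall p, p \in D -> fine (l (cyl p)) - eta <= fine (mu (cyl p))) ->
        `|integrals mu f - integrals l f| < e].
Proof.
case: f => f [cf bf] e0.
have [M M0 fM] : exists2 M, 0 < M & forall x, `|f x| <= M.
  have [N [_ fN]] := bf; exists (`|N| + 1); first by rewrite ltr_wpDl.
  by move=> x; apply: (fN (`|N| + 1)) => //; rewrite (le_lt_trans (ler_norm N))// ltrDl.
(* Chosen so that the error of [portmanteau_lower] for functions bounded by [2 * M] is [e / 4]. *)
pose e1 := e / 2 / (2 * (1 + 2 * M)) / 2.
have M1 : 0 < 2 * (1 + 2 * M) by lra.
have e10 : 0 < e1 by rewrite !divr_gt0.
have e1E : 2 * e1 + 2 * (2 * M * e1) < e.
  have -> : 2 * e1 + 2 * (2 * M * e1) = e / 4 by rewrite /e1; field; lra.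
  lra.
(* The lower bounds for the nonnegative functions [f + M] and [M - f] together bound the integral of
   [f] from both sides. *)
have cfM : continuous (fun x => f x + M : R^o).
  by move=> x; apply: (@cvgD R R^o _ (nbhs x)); [exact: cf|exact: cvg_cst].
have cMf : continuous (fun x => M - f x : R^o).
  by move=> x; apply: (@cvgB R R^o _ (nbhs x)); [exact: cvg_cst|exact: cf].
have bfM x : 0 <= f x + M <= 2 * M.
  by have := fM x; rewrite ler_norml => /andP[? ?]; apply/andP; split; lra.
have bMf x : 0 <= M - f x <= 2 * M.
  by have := fM x; rewrite ler_norml => /andP[? ?]; apply/andP; split; lra.
have [D1 [eta1 [eta10 D1K H1]]] := portmanteau_lower cfM bfM e10.
have [D2 [eta2 [eta20 D2K H2]]] := portmanteau_lower cMf bMf e10.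
exists (D1 ++ D2), (Num.min eta1 eta2); split.
- by rewrite lt_min eta10.
- by move=> p; rewrite mem_cat => /orP[/D1K|/D2K].
move=> mu lmu.
have fint (nu : probability (borel X) R) : nu.-integrable setT (EFin \o (f : borel X -> R)).
  apply: measurable_bounded_integrable => //.
  - by rewrite (le_lt_trans (probability_le1 _ _))// ltry.
  - exact: measurable_continuous.
have cint (nu : probability (borel X) R) : nu.-integrable setT (EFin \o cst M).
  by apply: finite_measure_integrable_cst.
have i1 (nu : probability (borel X) R) :
    (\int[nu]_x (f x + M)%:E = (integrals nu (exist _ f (conj cf bf)) + M)%:E)%E.
  have <- : Rintegral nu setT (fun x => f x + M) =
      integrals nu (exist _ f (conj cf bf)) + M.
    rewrite (RintegralD _ (fint nu) (cint nu))//; congr (_ + _).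
    rewrite [LHS]Rintegral_cst// [X in fine X](_ : _ = 1%E) ?mulr1//.
    exact: probability_setT.
  rewrite /Rintegral fineK//; apply: integrable_fin_num => //.
  exact: (integrableD measurableT (fint nu) (cint nu)).
have i2 (nu : probability (borel X) R) :
    (\int[nu]_x (M - f x)%:E = (M - integrals nu (exist _ f (conj cf bf)))%:E)%E.
  have <- : Rintegral nu setT (fun x => M - f x) =
      M - integrals nu (exist _ f (conj cf bf)).
    rewrite (RintegralB _ (cint nu) (fint nu))//; congr (_ - _).
    rewrite [LHS]Rintegral_cst// [X in fine X](_ : _ = 1%E) ?mulr1//.
    exact: probability_setT.
  rewrite /Rintegral fineK//; apply: integrable_fin_num => //.
  exact: (integrableB measurableT (cint nu) (fint nu)).
have := H1 mu; rewrite !i1 -EFinD lee_fin => {}H1.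
have := H2 mu; rewrite !i2 -EFinD lee_fin => {}H2.
have h1 : forall p, p \in D1 -> fine (l (cyl p)) - eta1 <= fine (mu (cyl p)).
  move=> p pD; apply: le_trans (lmu p _); last by rewrite mem_cat pD.
  by rewrite lerB// ge_min lexx.
have h2 : forall p, p \in D2 -> fine (l (cyl p)) - eta2 <= fine (mu (cyl p)).
  move=> p pD; apply: le_trans (lmu p _); last by rewrite mem_cat pD orbT.
  by rewrite lerB// ge_min lexx orbT.
move: (H1 h1) (H2 h2) => {}H1 {}H2.
by rewrite ltr_norml; apply/andP; split; lra.
Qed.

End Portmanteau.

(** * Convergence in probability *)

Lemma cvg_initial (S : choiceType) (T : topologicalType) (f : S -> T)
    (F : set_system S) (s : S) : Filter F ->
  f @ F --> f s -> F --> (s : initial_topology f).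
Proof.
move=> FF cf A [_ [[B Bop <-] Bfs sBA]]; apply: filterS sBA _.
by apply: cf; apply: open_nbhs_nbhs.
Qed.

(** Two layers of initial topologies are unfolded: the map [integrals], then the evaluations that
    generate the pointwise topology. *)
Lemma cvg_weak_probability (R : realType) (S : ptopologicalType)
    (F : set_system (weak_probability R S)) (l : weak_probability R S) :
  Filter F ->
  (forall f : bounded_continuous R S,
     integrals (mu : probability (borel S) R) f @[mu --> F] -->
     integrals (l : probability (borel S) R) f) ->
  F --> l.
Proof.
move=> FF cF; apply: cvg_initial => //.
apply/cvg_sup => f; apply: cvg_initial.
exact: cF.
Qed.

Section Eventually.
Context d (Omega : measurableType d) (R : realType) (P : probability Omega R).
Context (X : pointedType) (T : {RV P >-> discrete X}).
Variables (E : nat -> set Omega) (mE : forall n, measurable (E n)).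
Hypothesis E_pos : forall n, (0 < P (E n))%E.

Lemma cond_probE n (A : set Omega) :
  cond_prob P (mE n) A = (P (A `&` E n) * (fine (P (E n)))^-1%:E)%E.
Proof.
change ((if (P (setT `&` E n) == 0%E) || (P (setT `&` E n) == +oo%E)
  then fun U => P U
  else fun U => (P (U `&` E n) * ((fine (P (setT `&` E n)))^-1)%:E)%E) A =
  (P (A `&` E n) * (fine (P (E n)))^-1%:E)%E).
rewrite setTI gt_eqF//=.
by rewrite lt_eqF// (le_lt_trans (probability_le1 _ _))// ltry.
Qed.

Lemma measurable_RV (B : set X) : measurable (T @^-1` B).
Proof. by rewrite -[_ @^-1` _]setTI; exact: measurable_funP. Qed.

(** Stated for sets of values rather than events: the value space is discrete, so every preimage is
    measurable. *)
Definition with_high_prob (B : nat -> set X) : Prop :=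
  forall e : R, 0 < e -> \forall n \near \oo,
    fine (cond_prob P (mE n) (T @^-1` (~` B n))) <= e.

Lemma whpS (B D : nat -> set X) : (forall n x, B n x -> D n x) ->
  with_high_prob B -> with_high_prob D.
Proof.
move=> BD hB e e0; have := hB e e0; apply: filterS => n; apply: le_trans.
rewrite fine_le ?fin_num_measure//; try exact: measurable_RV.
apply: le_measure; rewrite ?inE; try exact: measurable_RV.
by move=> w /= nD Bw; apply: nD; exact: BD.
Qed.

Lemma whpI (B D : nat -> set X) : with_high_prob B -> with_high_prob D ->
  with_high_prob (fun n => B n `&` D n).
Proof.
move=> hB hD e e0; have e2 : 0 < e / 2 by rewrite divr_gt0.
have := hB _ e2; have := hD _ e2; apply: filterS2 => n h1 h2.
have mBC (C : set X) := measurable_RV C.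
have fn (C : set X) : cond_prob P (mE n) (T @^-1` C) \is a fin_num.
  by rewrite fin_num_measure.
rewrite (splitr e) -lee_fin fineK//.
apply: (@le_trans _ _ (cond_prob P (mE n) (T @^-1` (~` B n) `|` T @^-1` (~` D n)))).
  apply: le_measure; rewrite ?inE//; first exact: measurableU.
  move=> w /= nBD; have [Bw|] := pselect (B n (T w)); [right|by left].
  by move=> Dw; apply: nBD.
apply: (le_trans (measureU2 _ (mBC _) (mBC _))); rewrite EFinD.
rewrite -lee_fin fineK// in h1; rewrite -lee_fin fineK// in h2.
exact: leeD.
Qed.

Lemma whp_all (I : eqType) (r : seq I) (B : I -> nat -> set X) :
  (forall i, i \in r -> with_high_prob (B i)) ->
  with_high_prob (fun n x => forall i, i \in r -> B i n x).
Proof.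
elim: r => [_|i r IH hB].
  apply: (@whpS (fun _ => setT)) => // e e0; apply: nearW => n.
  by rewrite setCT preimage_set0 measure0 ltW.
apply: whpS (whpI (hB i (mem_head _ _)) (IH _)) => [n x [Bi Br] j|j jr].
  by rewrite in_cons => /predU1P[->//|/Br].
by apply: hB; rewrite in_cons jr orbT.
Qed.

Lemma cvg_whp (B : nat -> set X) :
  cond_prob P (mE n) [set w | B n (T w)] @[n --> \oo] --> 1%E <->
  with_high_prob B.
Proof.
have mBC (C : set X) := measurable_RV C.
have fn n (C : set X) : cond_prob P (mE n) (T @^-1` C) \is a fin_num.
  by rewrite fin_num_measure.
have BC n : fine (cond_prob P (mE n) (T @^-1` (~` B n))) =
    1 - fine (cond_prob P (mE n) (T @^-1` (B n))).
  rewrite -[1]/(fine 1%E) -fineB//; congr fine.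
  by rewrite -(probability_setC _ (mBC _)).
have le1 n : fine (cond_prob P (mE n) (T @^-1` (B n))) <= 1.
  by rewrite -lee_fin fineK// probability_le1.
split=> [/fine_cvg/cvgrPdist_le h e e0|h].
  have := h e e0; apply: filterS => n; rewrite BC; apply: le_trans.
  exact: ler_norm.
apply: cvg_EFin; first by apply: nearW => n; exact: fn.
apply/cvgrPdist_le => e e0; have := h e e0; apply: filterS => n; rewrite BC.
by move=> he; rewrite ger0_norm ?subr_ge0//; exact: le1.
Qed.

End Eventually.

(** * Fringe counts of the conditioned tree *)

Section LowerTail.
Context (R : realType) (G : typeSet).
Context d (Omega : measurableType d) (P : probability Omega R).
Context (sigma : G -> probability (discrete (seq G)) R)
  (alpha : {RV P >-> discrete G})
  (xi : seq nat -> G -> {RV P >-> discrete (seq G)}).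
Hypothesis hxi : offspring_family sigma alpha xi.
Context (T : {RV P >-> discrete (ptree G)}).
Hypothesis hT : gw_tree alpha xi T.
Variable kappa : G.
Context (E : nat -> set Omega) (mE : forall n, measurable (E n)).
Hypothesis hE : forall n, (0 < P (E n))%E.
Variable s : nat -> R.
Hypothesis hsE : forall e : R, 0 < e ->
  (fun n => expR (- (e * s n))) =o_\oo (fun n => fine (P (E n))).
Hypothesis hsT : cond_prob P (mE n) [set w | s n <= (ntype kappa (T w))%:R]
  @[n --> \oo] --> 1%E.
Local Notation a := (offspring_mass sigma).

Lemma whp_fringe_count tau delta : rtype tau = kappa -> 0 < delta ->
  with_high_prob T mE (fun _ => [set t : ptree G |
    (weight a tau - delta) * (ntype kappa t)%:R <= (fringe_count tau t)%:R]).
Proof.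
move=> tk d0.
pose Bad n := [set t : ptree G | s n <= (ntype kappa t)%:R /\
  (fringe_count tau t)%:R < (weight a tau - delta) * (ntype kappa t)%:R].
have big := (cvg_whp T mE (fun n => [set t : ptree G | s n <= (ntype kappa t)%:R])).1 hsT.
suff bad : with_high_prob T mE (fun n => ~` Bad n).
  apply: whpS (whpI big bad) => n t /= [st nbad].
  by rewrite leNgt; apply/negP => lt; apply: nbad.
move=> e e0.
have c0 : 0 < delta ^+ 2 / 4 by rewrite divr_gt0// exprn_gt0.
(* Conditioning costs at most a division by the probability of [E n]; with the rate of [lower_tail]
   as [e * s n], the quotient tends to 0. *)
have := hsE c0 => /eqoP /(_ e e0); apply: filterS => n.
rewrite !ger0_norm ?expR_ge0 ?fine_ge0// setCK cond_probE// => he.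
have PE : 0 < fine (P (E n)).
  by rewrite fine_gt0// hE (le_lt_trans (probability_le1 _ _))// ltry.
rewrite fineM// ?fin_num_measure//; last first.
  by apply: measurableI => //; exact: measurable_RV.
rewrite ler_pdivrMr//; apply: le_trans he.
have mBad := measurable_RV T (Bad n).
apply: (@le_trans _ _ (fine (P (T @^-1` Bad n)))).
  rewrite fine_le ?fin_num_measure//; first exact: measurableI.
  by apply: le_measure; rewrite ?inE//; exact: measurableI.
rewrite -lee_fin fineK ?fin_num_measure// -[leLHS]/(distribution P T (Bad n)).
apply: (@law_le (ptree G) _ _ pickle (pcan_inj pickleK)) => r ur rBad.
pose b g := fine (distribution P alpha [set g]).
apply: (@le_trans _ _ (\sum_(t <- r) (b (rtype t) * weight a t)%:E)%E).
  by apply: lee_sum => t _; exact: (gw_tree_mass hxi).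
rewrite sumEFin lee_fin; apply: (@lower_tail _ _ a _ _ b kappa tau delta) => //.
- exact: offspring_mass_ge0.
- exact: submass_offspring.
- by move=> g; exact: fine_ge0.
- exact: submass_law.
Qed.

End LowerTail.

Theorem theorem3
  (R : realType) (G : typeSet)
  (* the branching tree T, and versions of T(kappa) and T^kappa *)
  (d : measure_display) (Omega : measurableType d) (P : probability Omega R)
  (sigma : G -> probability (discrete (seq G)) R)
  (alpha : {RV P >-> discrete G})
  (xi : seq nat -> G -> {RV P >-> discrete (seq G)})
  (hxi : offspring_family sigma alpha xi)
  (T : {RV P >-> discrete (ptree G)}) (hT : gw_tree alpha xi T)
  (hpos : forall i : G, (0 < P [set w | ntype i (T w) != 0%N])%E)
  (kappa : G)
  (Tkappa : {RV P >-> discrete (ptree G)}) (hTkappa : gw_tree_from xi kappa Tkappa)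
  (Tstop : {RV P >-> discrete (ptree G)}) (hTstop : gw_tree_stopped xi kappa Tstop)
  (* the conditioning events *)
  (E : nat -> set Omega) (mE : forall n, measurable (E n))
  (hE : forall n, (0 < P (E n))%E)
  (hmean : mean_ntype kappa Tstop = 2%:E)
  (s : nat -> R) (hs : s n @[n --> \oo] --> +oo)
  (hsE : forall e : R, 0 < e ->
    (fun n => expR (- (e * s n))) =o_\oo (fun n => fine (P (E n))))
  (hsT : cond_prob P (mE n) [set w | s n <= (ntype kappa (T w))%:R]
           @[n --> \oo] --> 1%E)
  (* the set of types of the marked vertex *)
  (G0 : set G) (hG0 : G0 !=set0)
  (hG0mean : forall gamma, gamma \in G0 -> gamma != kappa ->
    (0 < mean_ntype gamma Tstop < +oo)%E)
  (hG0ratio : forall gamma, gamma \in G0 -> gamma != kappa ->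
    cvg_in_prob (fun n => cond_prob P (mE n)) (T := R^o)
      (fun _ w => (ntype gamma (T w))%:R / (ntype kappa (T w))%:R)
      (fine (mean_ntype gamma Tstop)))
  (hsum : (\esum_(gamma in G0) type_weight kappa Tstop gamma < +oo)%E)
  (hsumratio : cvg_in_prob (fun n => cond_prob P (mE n)) (T := R^o)
      (fun _ w => fine (\esum_(gamma in G0) (ntype gamma (T w))%:R%:E)
                  / (ntype kappa (T w))%:R)
      (fine (\esum_(gamma in G0) type_weight kappa Tstop gamma)))
  (* the limit tree with independent random type eta *)
  (d' : measure_display) (Omega' : measurableType d')
  (P' : probability Omega' R)
  (eta : {RV P' >-> discrete G})
  (Z0 : G -> {RV P' >-> discrete (ptree G * seq nat)%type})
  (Z : nat -> {RV P' >-> discrete (ptree G * seq nat)%type})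
  (C : nat -> seq nat -> {RV P' >-> discrete (ptree G)})
  (hcomp : limit_tree_components kappa G0 Tkappa Tstop eta Z0 Z C)
  (That : {RV P' >-> borel (limit_space G R)})
  (hThat : limit_tree kappa eta Z0 Z C That)
  (* arbitrary value of the conditional law if no vertex has type in G0 *)
  (mu0 : ptree G -> probability (borel (limit_space G R)) R) :
  cvg_in_prob (fun n => cond_prob P (mE n))
    (T := weak_probability R (limit_space G R))
    (fun _ w => fringe_law G0 mu0 (T w))
    (distribution P' That).
Proof.
pose a := offspring_mass sigma.
have a0 g r : 0 <= a g r by exact: offspring_mass_ge0.
set S := (\esum_(gamma in G0) type_weight kappa Tstop gamma)%E in hsum hsumratio.
have Spos : (0 < S)%E.
  have [g gG] := hG0.
  apply: (@lt_le_trans _ _ (type_weight kappa Tstop g)).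
    rewrite /type_weight; case: eqVneq => [_|gk]; first exact: lte01.
    by have /andP[] := hG0mean g (mem_set gG) gk.
  apply: esum_ge; exists [set g]; last by rewrite fsbig_set1.
  by split; [exact: finite_set1|move=> _ ->].
have Sfin : S \is a fin_num by rewrite ge0_fin_numE// ltW.
set S0 := fine S in hsumratio.
have S00 : 0 < S0 by rewrite fine_gt0// Spos.
have Troot : {ae P, forall w, rtype (Tkappa w : ptree G) = kappa}.
  by apply: ae_imply hTkappa => w [].
have wf := components_wf_ae hcomp Troot (gw_tree_stopped_blob hTstop) hmean
  hG0mean hsum Spos.
pose K := [set p : ptree G * seq nat | [/\ rtype p.1 = kappa, p.2 != [::] &
  is_true (if vtype p.1 p.2 is Some g then g \in G0 else false)]].
have Kdeep : {ae P', forall w, forall H : nat, exists p,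
    [/\ K p, (H <= size p.2)%N & cylinder (R := R) p.1 p.2 (That w)]}.
  apply: ae_imply2 hThat wf => w [y [yE ys]] [eG wZ0 wZ wC] H.
  pose zb := fun i => if i is j.+1 then Z j w else Z0 (eta w) w.
  pose cb := fun i v => C i v w.
  (* The fringe subtree at [u_H] is deep enough: [kcount] is [H.+1] there and is bounded by the
     length of the address. *)
  have [r1 v1 k1] := @spine_wf _ kappa zb cb (eta w) wZ0 wZ wC H.
  have := ys H; rewrite -/zb -/cb; set q := spine kappa zb cb H => yq.
  exists q; split.
  - split=> //; last by rewrite v1.
    by apply/eqP => q0; move: k1; rewrite -/q q0.
  - by apply: leq_trans (leqnSn H) _; rewrite -k1 kcount_size.
  - by rewrite /cylinder /= yE /= yq; case: (q).
have lq p : K p -> fine (distribution P' That (cylinder p.1 p.2)) <= weight a p.1 / S0.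
  move=> [pk p0 _]; rewrite -lee_fin fineK; last first.
    by rewrite fin_num_measure//; exact: measurable_cylinder.
  apply: (limit_cylinder_le hcomp a0 _ _ hG0mean hThat wf) => //.
  - by move=> t; exact: (gw_tree_from_mass hxi t hTkappa).
  - by move=> t; exact: (gw_tree_stopped_mass hxi t hTstop).
  - exact: measurable_cylinder.
have whp_cyl p eta0 : K p -> 0 < eta0 -> with_high_prob T mE (fun _ => [set t |
    fine (distribution P' That (cylinder p.1 p.2)) - eta0 <=
    fine (fringe_law G0 mu0 t (cylinder p.1 p.2))]).
  move=> Kp eta00; have [pk p0 pG] := Kp.
  set w := weight a p.1 in lq *.
  have w1 : w <= 1.
    have := @submass_weight _ _ a a0 (submass_offspring sigma) kappa [:: p.1] erefl.
    by rewrite big_seq1; apply=> t; rewrite inE => /eqP ->; apply/eqP.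
  (* The allowance [eta0 * S0] is split in two: half is [delta], half absorbs the relative error
     [delta' / S0] of the denominator. The bound [S0 / 2] keeps the ratio positive, so that vertices
     with type in [G0] exist. *)
  pose delta := eta0 * S0 / 2; pose delta' := Num.min (S0 / 2) (eta0 * S0 ^+ 2 / 2).
  have delta0 : 0 < delta by rewrite divr_gt0// mulr_gt0.
  have delta'0 : 0 < delta'.
    by rewrite lt_min !divr_gt0// mulr_gt0// exprn_gt0.
  have whpN := whp_fringe_count hxi hT hE hsE hsT pk delta0.
  have whpG : with_high_prob T mE (fun _ => [set t : ptree G |
      `|S0 - (marked_count G0 t)%:R / (ntype kappa t)%:R| < delta']).
    have oB : open_nbhs (S0 : R^o) (ball (S0 : R^o) delta').
      by split; [exact: ball_open|exact: ballxx].
    have := (cvg_whp T mE (fun _ => [set t : ptree G | ball (S0 : R^o) delta'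
      (fine (\esum_(gamma in G0) (ntype gamma t)%:R%:E) / (ntype kappa t)%:R)])).1
      (hsumratio _ oB).
    by apply: whpS => n t /=; rewrite esum_ntype.
  apply: whpS (whpI whpN whpG) => n t /= [].
  rewrite -/a -/w; set k := (ntype kappa t)%:R : R; set m := (marked_count G0 t)%:R : R.
  set N := (fringe_count p.1 t)%:R => hN; rewrite ltr_norml => /andP[hm1 hm2].
  have m0 : 0 < m / k.
    have : delta' <= S0 / 2 by rewrite ge_min lexx.
    lra.
  have k0 : 0 < k.
    by rewrite lt_neqAle ler0n andbT; apply/eqP => k0; move: m0; rewrite -k0 invr0 mulr0 ltxx.
  have mpos : (0 < marked_count G0 t)%N.
    by rewrite lt0n; apply/eqP => m00; move: m0; rewrite /m m00 mul0r ltxx.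
  have mk : m <= (S0 + delta') * k.
    by rewrite -ler_pdivrMr//; lra.
  have Nm : N / m <= fine (fringe_law G0 mu0 t (cylinder p.1 p.2)).
    rewrite -lee_fin fineK; last first.
      by rewrite fin_num_measure//; exact: measurable_cylinder.
    exact: (fringe_law_cylinder mu0 mpos p0 pG).
  apply: le_trans Nm; apply: (@le_trans _ _ (w / S0 - eta0)); first by rewrite lerB// lq.
  have m1 : 0 < m by rewrite ltr0n.
  rewrite ler_pdivlMr//.
  have [c0|c0] := leP (w / S0 - eta0) 0.
    by apply: le_trans (ler0n _ _); rewrite mulr_le0_ge0// ltW.
  apply: le_trans hN; apply: (@le_trans _ _ ((w / S0 - eta0) * ((S0 + delta') * k))).
    by rewrite ler_pM2l.
  rewrite mulrA ler_pM2r//.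
  have -> : (w / S0 - eta0) * (S0 + delta') =
      w - eta0 * S0 + w * (delta' / S0) - eta0 * delta' by field; rewrite gt_eqF.
  have h1 : delta' / S0 <= eta0 * S0 / 2.
    rewrite ler_pdivrMr// (_ : _ / 2 * S0 = eta0 * S0 ^+ 2 / 2); last by field.
    by rewrite ge_min lexx orbT.
  have h2 : w * (delta' / S0) <= delta' / S0.
    by rewrite ler_piMl// divr_ge0// ltW.
  have h3 : 0 < eta0 * delta' by rewrite mulr_gt0.
  rewrite /delta; lra.
(* The sets of laws that contain the empirical law with high probability form a filter; convergence
   in probability to a constant is convergence of this filter, so the topological lemmas apply. *)
pose F : set_system (weak_probability R (limit_space G R)) := [set A |
  with_high_prob T mE (fun _ => [set t | A (fringe_law G0 mu0 t)])].
have FF : Filter F.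
  split.
  - by move=> e e0; apply: nearW => n; rewrite setCT preimage_set0 measure0 ltW.
  - by move=> A B hA hB; exact: (whpI hA hB).
  - by move=> A B AB; apply: whpS => n t; exact: AB.
have Fl : F --> (distribution P' That : weak_probability R (limit_space G R)).
  apply: cvg_weak_probability => f; apply/cvgrPdist_lt => e e0.
  have [D [eta0 [eta00 DK HD]]] := portmanteau Kdeep f e0.
  have := whp_all (fun p pD => whp_cyl p eta0 (DK p pD) eta00).
  by apply: whpS => n t ht; rewrite /= distrC; exact: HD.
move=> U Ul; apply/(cvg_whp T mE (fun _ => [set t | U (fringe_law G0 mu0 t)])).
exact: (Fl U (open_nbhs_nbhs Ul)).
Qed.
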